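(* If $R$ is a $1$-place ring, then the group $\mathrm{SL}_2(R)$ is not finitely generated.
   Context: Let $C$ be an irreducible smooth projective curve defined over an algebraically closed field $k$, and let $k(C)$ be its field of rational functions. For each point $x\in C$ let $v_x\colon k(C)^\times\to\mathbb{Z}$ be the discrete valuation assigning to a nonzero function its vanishing order at $x$, extended by $v_x(0)=\infty$. A ring $R$ is called a $1$-place ring if there are such $k$ and $C$ and a finite nonempty set $S_1\subseteq C$ of closed points such that $R$ is a subring of $k(C)$ containing the constant function $1$ and some nonconstant function, and such that: (1) for all $f\in R$ and all $x\in C\setminus S_1$, $v_x(f)\ge 0$; (2) if there are an $x\in S_1$ and an $f\in R$ with $v_x(f)<0$, then $v_y(f)<0$ for all $y\in S_1$. *)

(* Defs.v *)
From HB Require Import structures.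
From mathcomp Require Import all_boot all_order all_algebra generic_quotient.
From mathcomp Require Import boolp classical_sets.
From mathcomp.multinomials Require Import mpoly.
From mathcomp Require Import ring.

Set Implicit Arguments.
Unset Strict Implicit.
Unset Printing Implicit Defensive.

Import GRing.Theory Num.Theory.
Local Open Scope classical_set_scope.
Local Open Scope ring_scope.
Local Open Scope quotient_scope.

Section ProjectiveSpace.

Variables (k : closedFieldType) (n : nat).

(** Projective n-space over k: the set of lines of k^(n+1). *)
Definition pspace : Type := {L : {vspace 'rV[k]_n.+1} | \dim L == 1%N}.

HB.instance Definition _ := Choice.on pspace.

(** Homogeneous coordinates of a point; their choice is immaterial, as every
    condition on [form_at] below is homogeneous in them. *)
Definition hcoord (x : pspace) : 'I_n.+1 -> k := fun i => vpick (val x) 0 i.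

Definition form_at (F : {mpoly k[n.+1]}) (x : pspace) : k := F.@[hcoord x].

Definition pclosed (Z : set pspace) : Prop :=
  exists T : set {mpoly k[n.+1]},
    (forall F, T F -> exists d, F \is d.-homog) /\
    Z = [set x | forall F, T F -> form_at F x = 0].

Definition pirreducible (Z : set pspace) : Prop :=
  Z !=set0 /\
  forall Y1 Y2, pclosed Y1 -> pclosed Y2 ->
    Z `<=` Y1 `|` Y2 -> Z `<=` Y1 \/ Z `<=` Y2.

(** [Y 0, ..., Y d] is a strictly increasing chain of irreducible closed
    subsets of [Z]. *)
Definition pchain (Z : set pspace) (d : nat) (Y : nat -> set pspace) : Prop :=
  (forall i, (i <= d)%N -> [/\ pclosed (Y i), pirreducible (Y i) & Y i `<=` Z])
  /\ (forall i, (i < d)%N -> Y i `<` Y i.+1).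

Definition has_pdim (Z : set pspace) (d : nat) : Prop :=
  (exists Y, pchain Z d Y) /\ ~ (exists Y, pchain Z d.+1 Y).

Definition pvanishing (Z : set pspace) (F : {mpoly k[n.+1]}) : Prop :=
  (exists d, F \is d.-homog) /\ forall x, Z x -> form_at F x = 0.

Definition in_tangent (Z : set pspace) (x : pspace) (w : 'rV[k]_n.+1) : Prop :=
  forall F, pvanishing Z F -> \sum_(i < n.+1) form_at F^`M(i) x * w 0 i = 0.

(** Jacobian criterion at a point of a [d]-dimensional [Z]. The forms have n+1
    variables, so the kernel of the Jacobian matrix is the tangent space of the
    affine cone over [Z], whose dimension is one more than that of the tangent
    space of [Z]; equivalently, the Jacobian matrix has rank n - d. *)
Definition psmooth_at (Z : set pspace) (d : nat) (x : pspace) : Prop :=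
  exists T : {vspace 'rV[k]_n.+1},
    \dim T = d.+1 /\ forall w, w \in T <-> in_tangent Z x w.

End ProjectiveSpace.

Record smooth_projective_curve (k : closedFieldType) (n : nat) : Type :=
  SmoothProjectiveCurve {
    on_curve : set (pspace k n);
    curve_closed : pclosed on_curve;
    curve_irreducible : pirreducible on_curve;
    curve_dim1 : has_pdim on_curve 1;
    curve_smooth : forall x, on_curve x -> psmooth_at on_curve 1 x
  }.

Section FunctionField.

Variables (k : closedFieldType) (n : nat) (C : smooth_projective_curve k n).

Local Notation form := {mpoly k[n.+1]}.

Definition nonzero_on (F : form) : bool :=
  `[< exists2 x, on_curve C x & form_at F x != 0 >].

(** The triple (d, G, H) stands for the fraction G / H of forms of degree d. *)
Record ratfun_rep : Type := RatfunRep {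
  rf_triple : nat * form * form;
  rf_axiom : [&& rf_triple.1.2 \is rf_triple.1.1.-homog,
                 rf_triple.2 \is rf_triple.1.1.-homog & nonzero_on rf_triple.2]
}.

HB.instance Definition _ := [isSub for rf_triple].
HB.instance Definition _ := [Choice of ratfun_rep by <:].

Definition rf_deg (f : ratfun_rep) : nat := (rf_triple f).1.1.
Definition rf_num (f : ratfun_rep) : form := (rf_triple f).1.2.
Definition rf_den (f : ratfun_rep) : form := (rf_triple f).2.

Lemma rf_num_homog f : rf_num f \is (rf_deg f).-homog.
Proof. by case/and3P: (rf_axiom f). Qed.

Lemma rf_den_homog f : rf_den f \is (rf_deg f).-homog.
Proof. by case/and3P: (rf_axiom f). Qed.

Lemma rf_den_nz f : nonzero_on (rf_den f).
Proof. by case/and3P: (rf_axiom f). Qed.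

Lemma form_atM (F G : form) x : form_at (F * G) x = form_at F x * form_at G x.
Proof. exact: mevalM. Qed.

Lemma form_atD (F G : form) x : form_at (F + G) x = form_at F x + form_at G x.
Proof. exact: mevalD. Qed.

Lemma form_atN (F : form) x : form_at (- F) x = - form_at F x.
Proof. exact: mevalN. Qed.

Lemma form_at0 x : form_at (0 : form) x = 0.
Proof. exact: meval0. Qed.

Lemma form_atC c x : form_at (c%:MP : form) x = c.
Proof. exact: mevalC. Qed.

Lemma form_at1 x : form_at (1 : form) x = 1.
Proof. exact: meval1. Qed.

Definition form_atE := (form_atM, form_atD, form_atN, form_at0, form_at1, form_atC).

Lemma pclosed_form (F : form) d :
  F \is d.-homog -> pclosed [set x | form_at F x = 0].
Proof.
move=> hF; exists (fun G => G = F); split=> [_ ->|]; first by exists d.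
by apply/seteqP; split=> x /=; [move=> Fx _ ->|apply].
Qed.

Lemma nonzero_onPn (F : form) :
  ~~ nonzero_on F -> forall x, on_curve C x -> form_at F x = 0.
Proof.
move=> /asboolPn nF x Cx; apply: contrapT => /eqP Fx.
by apply: nF; exists x.
Qed.

Lemma nonzero_onM (F G : form) d e :
  F \is d.-homog -> G \is e.-homog -> nonzero_on F -> nonzero_on G ->
  nonzero_on (F * G).
Proof.
move=> hF hG nF nG; apply/asboolP; apply: contrapT => nFG.
have [_ irr] := curve_irreducible C.
have FG : on_curve C `<=` [set x | form_at F x = 0] `|` [set x | form_at G x = 0].
  move=> x Cx; have [|Fx] := eqVneq (form_at F x) 0; first by left.
  have [|Gx] := eqVneq (form_at G x) 0; first by right.
  by case: nFG; exists x => //; rewrite form_atM mulf_neq0.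
have [Z|Z] := irr _ _ (pclosed_form hF) (pclosed_form hG) FG.
  by have /asboolP[x /Z -> /eqP] := nF.
by have /asboolP[x /Z -> /eqP] := nG.
Qed.

Lemma nonzero_on1 : nonzero_on 1.
Proof.
have [[x Cx] _] := curve_irreducible C.
by apply/asboolP; exists x => //; rewrite form_at1 oner_neq0.
Qed.

Definition mk_ratfun d (G H : form) (hG : G \is d.-homog) (hH : H \is d.-homog)
    (nH : nonzero_on H) : ratfun_rep :=
  @RatfunRep (d, G, H) (introT and3P (And3 hG hH nH)).

(** The pairs (G, H) and (G', H') are identified when GH' - G'H is in the
    homogeneous ideal of C. *)
Definition ratfun_equiv (f g : ratfun_rep) : bool :=
  `[< forall x, on_curve C x ->
        form_at (rf_num f * rf_den g) x = form_at (rf_num g * rf_den f) x >].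

Lemma cancel_form (F A B : form) d e : F \is d.-homog -> A - B \is e.-homog ->
  nonzero_on F ->
  (forall x, on_curve C x -> form_at (F * A) x = form_at (F * B) x) ->
  forall x, on_curve C x -> form_at A x = form_at B x.
Proof.
move=> hF hAB nF E; suff /nonzero_onPn Z : ~~ nonzero_on (A - B).
  by move=> x /Z /eqP; rewrite !form_atE subr_eq0 => /eqP.
apply/negP => nAB; have /asboolP[x Cx /eqP[]] := nonzero_onM hF hAB nF nAB.
by rewrite !form_atE mulrDr mulrN -!form_atM E ?subrr.
Qed.

Lemma ratfun_equiv_refl : reflexive ratfun_equiv.
Proof. by move=> f; apply/asboolP. Qed.

Lemma ratfun_equiv_sym f g : ratfun_equiv f g = ratfun_equiv g f.
Proof. by apply/asboolP/asboolP => E x /E ->. Qed.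

Lemma ratfun_equiv_trans : transitive ratfun_equiv.
Proof.
move=> g f h /asboolP fg /asboolP gh; apply/asboolP.
apply: (cancel_form (d := rf_deg g) (e := rf_deg f + rf_deg h)
  (F := rf_den g)); rewrite ?rf_den_homog ?rf_den_nz //.
  apply: rpredB; last rewrite addnC;
    by apply: dhomogM; rewrite ?rf_num_homog ?rf_den_homog.
move=> x Cx; have := fg x Cx; have := gh x Cx; rewrite !form_atM => {}gh {}fg.
by rewrite mulrA [form_at (rf_den g) x * _]mulrC fg mulrAC gh mulrAC mulrC mulrA.
Qed.

Canonical ratfun_equiv_rel :=
  EquivRel ratfun_equiv ratfun_equiv_refl ratfun_equiv_sym ratfun_equiv_trans.

(** The field k(C) of rational functions on C. *)
Definition function_field : Type := {eq_quot ratfun_equiv}.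

HB.instance Definition _ : EqQuotient _ ratfun_equiv function_field :=
  EqQuotient.on function_field.
HB.instance Definition _ := Choice.on function_field.

Local Notation K := function_field.

Lemma ratfunP (f g : ratfun_rep) :
  \pi_K f = \pi_K g <->
  forall x, on_curve C x -> form_at (rf_num f) x * form_at (rf_den g) x =
                   form_at (rf_num g) x * form_at (rf_den f) x.
Proof.
split=> [/eqmodP/asboolP E x /E|E]; first by rewrite !form_atM.
by apply/eqmodP/asboolP => x Cx; rewrite !form_atM E.
Qed.

Lemma mpolyC_homog (c : k) : (c%:MP : form) \is 0.-homog.
Proof. by rewrite -alg_mpolyC rpredZ ?dhomog1. Qed.

Definition rf_const (c : k) : ratfun_rep :=
  mk_ratfun (mpolyC_homog c) (dhomog1 _ _) nonzero_on1.

Lemma rf_denM_nz f g : nonzero_on (rf_den f * rf_den g).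
Proof.
exact: nonzero_onM (rf_den_homog f) (rf_den_homog g) (rf_den_nz f) (rf_den_nz g).
Qed.

Lemma rf_add_homog f g :
  rf_num f * rf_den g + rf_num g * rf_den f \is (rf_deg f + rf_deg g).-homog.
Proof.
apply: rpredD; last rewrite addnC;
  by apply: dhomogM; rewrite ?rf_num_homog ?rf_den_homog.
Qed.

Definition rf_add (f g : ratfun_rep) : ratfun_rep :=
  mk_ratfun (rf_add_homog f g)
    (dhomogM (rf_den_homog f) (rf_den_homog g)) (rf_denM_nz f g).

Definition rf_mul (f g : ratfun_rep) : ratfun_rep :=
  mk_ratfun (dhomogM (rf_num_homog f) (rf_num_homog g))
    (dhomogM (rf_den_homog f) (rf_den_homog g)) (rf_denM_nz f g).

Lemma rf_opp_homog f : - rf_num f \is (rf_deg f).-homog.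
Proof. by rewrite rpredN rf_num_homog. Qed.

Definition rf_opp (f : ratfun_rep) : ratfun_rep :=
  mk_ratfun (rf_opp_homog f) (rf_den_homog f) (rf_den_nz f).

Definition rf_inv (f : ratfun_rep) : ratfun_rep :=
  if @idP (nonzero_on (rf_num f)) is ReflectT nz
  then mk_ratfun (rf_den_homog f) (rf_num_homog f) nz
  else rf_const 0.

Lemma rf_num_mk d G H hG hH nH :
  rf_num (@mk_ratfun d G H hG hH nH) = G.
Proof. by []. Qed.

Lemma rf_den_mk d G H hG hH nH :
  rf_den (@mk_ratfun d G H hG hH nH) = H.
Proof. by []. Qed.

Lemma rf_num_const c :
  rf_num (rf_const c) = c%:MP.
Proof. by []. Qed.

Lemma rf_den_const c :
  rf_den (rf_const c) = 1.
Proof. by []. Qed.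

Lemma rf_num_add f g :
  rf_num (rf_add f g) = rf_num f * rf_den g + rf_num g * rf_den f.
Proof. by []. Qed.

Lemma rf_den_add f g :
  rf_den (rf_add f g) = rf_den f * rf_den g.
Proof. by []. Qed.

Lemma rf_num_mul f g :
  rf_num (rf_mul f g) = rf_num f * rf_num g.
Proof. by []. Qed.

Lemma rf_den_mul f g :
  rf_den (rf_mul f g) = rf_den f * rf_den g.
Proof. by []. Qed.

Lemma rf_num_opp f :
  rf_num (rf_opp f) = - rf_num f.
Proof. by []. Qed.

Lemma rf_den_opp f :
  rf_den (rf_opp f) = rf_den f.
Proof. by []. Qed.

Definition rf_opE := (rf_num_mk, rf_den_mk, rf_num_const, rf_den_const,
  rf_num_add, rf_den_add, rf_num_mul, rf_den_mul, rf_num_opp, rf_den_opp).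

Definition ff_const (c : k) : K := \pi_K (rf_const c).
Definition ff_add (f g : K) : K := \pi_K (rf_add (repr f) (repr g)).
Definition ff_mul (f g : K) : K := \pi_K (rf_mul (repr f) (repr g)).
Definition ff_opp (f : K) : K := \pi_K (rf_opp (repr f)).
Definition ff_inv (f : K) : K := \pi_K (rf_inv (repr f)).

Lemma repr_ratfun f x : on_curve C x ->
  form_at (rf_num (repr (\pi_K f))) x * form_at (rf_den f) x =
  form_at (rf_num f) x * form_at (rf_den (repr (\pi_K f))) x.
Proof. by move: x; apply/ratfunP; rewrite reprK. Qed.

Lemma ff_addE f g : ff_add (\pi_K f) (\pi_K g) = \pi_K (rf_add f g).
Proof.
apply/ratfunP => x Cx;
  rewrite !rf_opE !form_atE.
have Ef := repr_ratfun f Cx; have Eg := repr_ratfun g Cx.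
set a := form_at (rf_num (repr (\pi_K f))) x in Ef *.
set b := form_at (rf_den (repr (\pi_K f))) x in Ef *.
set c := form_at (rf_num (repr (\pi_K g))) x in Eg *.
set d := form_at (rf_den (repr (\pi_K g))) x in Eg *.
transitivity (a * form_at (rf_den f) x * (d * form_at (rf_den g) x) +
              c * form_at (rf_den g) x * (b * form_at (rf_den f) x)).
  by ring.
by rewrite Ef Eg; ring.
Qed.

Lemma ff_mulE f g : ff_mul (\pi_K f) (\pi_K g) = \pi_K (rf_mul f g).
Proof.
apply/ratfunP => x Cx;
  rewrite !rf_opE !form_atE.
by rewrite mulrACA !repr_ratfun // mulrACA.
Qed.

Lemma ff_oppE f : ff_opp (\pi_K f) = \pi_K (rf_opp f).
Proof.
apply/ratfunP => x Cx;
  rewrite !rf_opE !form_atE.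
by rewrite !mulNr repr_ratfun.
Qed.

Lemma ff_eq0 f : reflect (\pi_K f = ff_const 0) (~~ nonzero_on (rf_num f)).
Proof.
apply: (iffP idP) => [/nonzero_onPn Z|/ratfunP E].
  by apply/ratfunP => x Cx; rewrite Z // !rf_opE !form_atE !mul0r.
apply/negP => /asboolP[x Cx /eqP[]].
by have := E x Cx; rewrite !rf_opE !form_atE mulr1 mul0r.
Qed.

Lemma ff_addA : associative ff_add.
Proof.
elim/quotW=> f; elim/quotW=> g; elim/quotW=> h.
rewrite (ff_addE g h) (ff_addE f g) (ff_addE f) (ff_addE _ h).
apply/ratfunP => x Cx.
by rewrite !rf_opE !form_atE; ring.
Qed.

Lemma ff_addC : commutative ff_add.
Proof.
elim/quotW=> f; elim/quotW=> g; rewrite !ff_addE.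
apply/ratfunP => x Cx.
by rewrite !rf_opE !form_atE; ring.
Qed.

Lemma ff_add0 : left_id (ff_const 0) ff_add.
Proof.
elim/quotW=> f; rewrite !ff_addE.
apply/ratfunP => x Cx.
by rewrite !rf_opE !form_atE; ring.
Qed.

Lemma ff_addN : left_inverse (ff_const 0) ff_opp ff_add.
Proof.
elim/quotW=> f; rewrite (ff_oppE f) (ff_addE _ f).
apply/ratfunP => x Cx.
by rewrite !rf_opE !form_atE; ring.
Qed.

HB.instance Definition _ :=
  GRing.isZmodule.Build K ff_addA ff_addC ff_add0 ff_addN.

Lemma ff_mulA : associative ff_mul.
Proof.
elim/quotW=> f; elim/quotW=> g; elim/quotW=> h.
rewrite (ff_mulE g h) (ff_mulE f g) (ff_mulE f) (ff_mulE _ h).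
apply/ratfunP => x Cx.
by rewrite !rf_opE !form_atE; ring.
Qed.

Lemma ff_mulC : commutative ff_mul.
Proof.
elim/quotW=> f; elim/quotW=> g; rewrite !ff_mulE.
apply/ratfunP => x Cx.
by rewrite !rf_opE !form_atE; ring.
Qed.

Lemma ff_mul1 : left_id (ff_const 1) ff_mul.
Proof.
elim/quotW=> f; rewrite !ff_mulE.
apply/ratfunP => x Cx.
by rewrite !rf_opE !form_atE; ring.
Qed.

Lemma ff_mulDl : left_distributive ff_mul ff_add.
Proof.
elim/quotW=> f; elim/quotW=> g; elim/quotW=> h.
rewrite (ff_addE f g) (ff_mulE f h) (ff_mulE g h) ff_mulE ff_addE.
apply/ratfunP => x Cx.
by rewrite !rf_opE !form_atE; ring.
Qed.

Lemma ff_1neq0 : ff_const 1 != ff_const 0.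
Proof. by apply/eqP => /ff_eq0; rewrite rf_opE mpolyC1 nonzero_on1. Qed.

HB.instance Definition _ :=
  GRing.Zmodule_isComNzRing.Build K ff_mulA ff_mulC ff_mul1 ff_mulDl ff_1neq0.

Lemma ff_mulV (f : K) : f != ff_const 0 -> ff_mul (ff_inv f) f = ff_const 1.
Proof.
move=> nf; rewrite -{2}[f]reprK ff_mulE; move: nf; rewrite -{1}[f]reprK.
move: (repr f) => {}f /eqP nf0; rewrite /rf_inv.
have nf : nonzero_on (rf_num f) by apply/negPn/negP => /ff_eq0.
case: {-}_ / idP => [nz|/(_ nf)//]; apply/ratfunP => x Cx.
by rewrite !rf_opE !form_atE; ring.
Qed.

Lemma ff_inv0 : ff_inv (ff_const 0) = ff_const 0.
Proof.
rewrite /ff_inv /rf_inv; case: {-}_ / idP => // nz.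
suff /negP[] : ~~ nonzero_on (rf_num (repr (ff_const 0))) by [].
by apply/ff_eq0; rewrite reprK.
Qed.

HB.instance Definition _ := GRing.ComNzRing_isField.Build K ff_mulV ff_inv0.

(** [regular_at x] and [vanishes_at x] are the local ring of C at x and its
    maximal ideal. *)
Definition regular_at (x : pspace k n) (f : K) : Prop :=
  exists2 r : ratfun_rep, f = \pi_K r & form_at (rf_den r) x != 0.

Definition vanishes_at (x : pspace k n) (f : K) : Prop :=
  exists2 r : ratfun_rep, f = \pi_K r &
    form_at (rf_den r) x != 0 /\ form_at (rf_num r) x = 0.

Definition uniformizer_at (x : pspace k n) (t : K) : Prop :=
  [/\ t != 0, vanishes_at x t &
      forall f, vanishes_at x f -> exists2 g, regular_at x g & f = g * t].

Definition is_order_at (x : pspace k n) (f : K) (m : int) : Prop :=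
  exists t u : K, [/\ uniformizer_at x t, regular_at x u, ~ vanishes_at x u
                    & f = u * t ^ m].

(** The order of vanishing v_x; [None] stands for infinity. *)
Definition ord_at (x : pspace k n) (f : K) : option int :=
  if f == 0 then None else Some (xget 0 (is_order_at x f)).

End FunctionField.

Definition order_ge0 (v : option int) : bool :=
  if v is Some m then 0 <= m else true.
Definition order_lt0 (v : option int) : bool :=
  if v is Some m then m < 0 else false.

(** A ring is a 1-place ring when it is isomorphic, through [iota], to a subring
    of the function field with the listed properties. *)
Definition one_place_ring (R : comNzRingType) : Prop :=
  exists (k : closedFieldType) (n : nat) (C : smooth_projective_curve k n)
         (S1 : seq (pspace k n)) (iota : {rmorphism R -> function_field C}),
    [/\ injective iota,
        S1 != [::] /\ (forall x, x \in S1 -> on_curve C x),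
        exists f : R, forall c : k, iota f <> ff_const C c,
        forall (f : R) (x : pspace k n), on_curve C x -> x \notin S1 ->
          order_ge0 (ord_at x (iota f)) &
        forall f : R,
          (exists2 x, x \in S1 & order_lt0 (ord_at x (iota f))) ->
          forall y, y \in S1 -> order_lt0 (ord_at y (iota f))].

Section SpecialLinear.

Variables (m : nat) (R : comNzRingType).

Definition SL : Type := {A : 'M[R]_m | \det A == 1}.

HB.instance Definition _ := Choice.on SL.

Lemma sl1_subproof : \det (1%:M : 'M[R]_m) == 1.
Proof. by rewrite det1. Qed.

Lemma slM_subproof (A B : SL) : \det (val A *m val B) == 1.
Proof. by rewrite det_mulmx (eqP (valP A)) (eqP (valP B)) mulr1. Qed.

Lemma slV_subproof (A : SL) : \det (\adj (val A)) == 1.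
Proof.
have := congr1 determinant (mul_mx_adj (val A)).
by rewrite det_mulmx (eqP (valP A)) mul1r det1 => ->.
Qed.

Definition sl1 : SL := Sub 1%:M sl1_subproof.
Definition slM (A B : SL) : SL := Sub (val A *m val B) (slM_subproof A B).
(** The adjugate of a matrix of determinant 1 is its inverse. *)
Definition slV (A : SL) : SL := Sub (\adj (val A)) (slV_subproof A).

Lemma slMA : associative slM.
Proof. by move=> A B D; apply: val_inj; rewrite /= mulmxA. Qed.

Lemma sl1M : left_id sl1 slM.
Proof. by move=> A; apply: val_inj; rewrite /= mul1mx. Qed.

Lemma slM1 : right_id sl1 slM.
Proof. by move=> A; apply: val_inj; rewrite /= mulmx1. Qed.

Lemma slVM : left_inverse sl1 slV slM.
Proof. by move=> A; apply: val_inj; rewrite /= mul_adj_mx (eqP (valP A)). Qed.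

Lemma slMV : right_inverse sl1 slV slM.
Proof. by move=> A; apply: val_inj; rewrite /= mul_mx_adj (eqP (valP A)). Qed.

HB.instance Definition _ := isGroup.Build SL slMA sl1M slM1 slVM slMV.

End SpecialLinear.

Definition finitely_generated (G : groupType) : Prop :=
  exists s : seq G, forall H : {pred G},
    group_closed H -> {subset s <= H} -> forall g, g \in H.

(* Main.v *)
(** Let v be the order at a point x of S1. A function of R that is regular at x
    is regular everywhere, hence constant; so v <= 0 on R \ {0}, and v < 0 at a
    nonconstant function. Thus nu f = 2 ^ (- v f) is a multiplicative ultrametric
    norm on R with values in the natural numbers, and it is unbounded.

    For such a norm, let N be the maximum norm on R^2 and let r in R be large
    compared with the entries of finitely many matrices s. The condition
    N (h e2) < N (h (e2 + r e1)) on h in SL_2(R) is unchanged when h is replaced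
    by s h: otherwise h e2 and h (e2 + r e1) are both long, since h e1 is a
    nonzero vector of R^2 and has norm at least 1, while the area they span is
    only nu r; so they are nearly parallel, and s dilates them by the same factor.
    The condition thus defines a set stable under the group generated by the
    s; as it holds for 1 but not for the transvection by - r, the group
    is not all of SL_2(R). Geometrically, the path in the Bruhat-Tits tree from
    the base vertex to its image under the transvection climbs arbitrarily far
    into the cusp.

    On the curve, functions without poles are constant because a nonconstant f
    has a place with value in k at which 1/f vanishes (Chevalley), and that place
    is centered at a point of the projective curve. Orders exist because the
    Jacobian criterion and Nakayama's lemma make the maximal ideal of the local
    ring principal, and the Hilbert basis theorem bounds the divisibility of a
    function by a uniformizer. *)

From HB Require Import structures.
Require Import Defs.
From mathcomp Require Import all_boot all_order all_algebra generic_quotient.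
From mathcomp Require Import boolp classical_sets.
From mathcomp.multinomials Require Import mpoly.
From mathcomp Require Import zify ring.

Set Implicit Arguments.
Unset Strict Implicit.
Unset Printing Implicit Defensive.

Import Order.TTheory GRing.Theory Num.Theory.
Local Open Scope classical_set_scope.
Local Open Scope ring_scope.
Local Open Scope quotient_scope.

(** * Groups over discretely normed rings *)

Lemma det_mx22 (R : comNzRingType) (M : 'M[R]_2) :
  \det M = M 0 0 * M 1 1 - M 0 1 * M 1 0.
Proof.
rewrite (expand_det_row _ 0) !big_ord_recl big_ord0 addr0 /cofactor !det_mx11 !mxE.
rewrite expr0 expr1 mul1r mulN1r mulrN.
by congr (M _ _ * M _ _ - M _ _ * M _ _); apply/val_inj.
Qed.

Section DiscretelyNormedRing.

Variables (R : comNzRingType) (nu : R -> nat).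
Hypothesis nuM : forall f g, nu (f * g) = (nu f * nu g)%N.
Hypothesis nuD : forall f g, (nu (f + g) <= maxn (nu f) (nu g))%N.
Hypothesis nu_eq0 : forall f, (nu f == 0%N) = (f == 0).

Lemma nu1 : nu 1 = 1%N.
Proof.
have /eqP := nuM 1 1; rewrite mulr1 -{1}[nu 1]muln1 eqn_pmul2l.
  by move/eqP.
by rewrite lt0n nu_eq0 oner_eq0.
Qed.

Lemma nuN f : nu (- f) = nu f.
Proof.
have /eqP : (nu (-1) * nu (-1) = 1)%N by rewrite -nuM mulrNN mulr1 nu1.
by rewrite muln_eq1 andbb => /eqP N1; rewrite -mulN1r nuM N1 mul1n.
Qed.

Definition vnorm (x y : R) : nat := maxn (nu x) (nu y).

Lemma vnormZ f x y : vnorm (f * x) (f * y) = (nu f * vnorm x y)%N.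
Proof. by rewrite /vnorm !nuM maxnMr. Qed.

Lemma vnormD x y x' y' :
  (vnorm (x + x') (y + y') <= maxn (vnorm x y) (vnorm x' y'))%N.
Proof. have := nuD x x'; have := nuD y y'; rewrite /vnorm; lia. Qed.

Lemma vnormN x y : vnorm (- x) (- y) = vnorm x y.
Proof. by rewrite /vnorm !nuN. Qed.

(** A strictly shorter summand cannot change an ultrametric norm: subtracting it again recovers the
    longer one. *)
Lemma vnormDr x y x' y' : (vnorm x' y' < vnorm x y)%N ->
  vnorm (x + x') (y + y') = vnorm x y.
Proof.
move=> lt; have := vnormD x y x' y'.
by have := vnormD (x + x') (y + y') (- x') (- y'); rewrite !addrK vnormN; lia.
Qed.

Lemma vnormC x y : vnorm x y = vnorm y x.
Proof. exact: maxnC. Qed.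

Lemma vnorm_mulmx_le D a b c d x y :
  [&& nu a <= D, nu b <= D, nu c <= D & nu d <= D]%N ->
  (vnorm (a * x + b * y) (c * x + d * y) <= D * vnorm x y)%N.
Proof.
case/and4P=> aD bD cD dD.
have le z u v w : (nu z <= D -> nu u <= D ->
    nu (z * v + u * w)%R <= D * maxn (nu v) (nu w))%N.
  move=> zD uD; apply: leq_trans (nuD _ _) _; rewrite !nuM maxnMr geq_max !leq_max.
  by rewrite !leq_mul2r zD uD !orbT.
by rewrite geq_max !le.
Qed.

(* Two vectors that are almost parallel, in that the area they span is small
   compared with the product of their lengths, are dilated by the same factor. *)
Lemma vnorm_mulmx_parallel_aux D a b c d p1 p2 q1 q2 :
  [&& nu a <= D, nu b <= D, nu c <= D & nu d <= D]%N ->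
  (nu p2 <= nu p1)%N ->
  (nu (p1 * q2 - p2 * q1)%R < vnorm p1 p2 * vnorm q1 q2)%N ->
  (D * nu (p1 * q2 - p2 * q1)%R <
   vnorm p1 p2 * vnorm (a * q1 + b * q2)%R (c * q1 + d * q2)%R)%N ->
  (vnorm q1 q2 * vnorm (a * p1 + b * p2)%R (c * p1 + d * p2)%R =
   vnorm p1 p2 * vnorm (a * q1 + b * q2)%R (c * q1 + d * q2)%R)%N.
Proof.
case/and4P=> aD bD cD dD le21.
have -> : vnorm p1 p2 = nu p1 by apply/maxn_idPl.
set e := p1 * q2 - p2 * q1 => area large.
(* If [q2] dominated, [p1 * q2 = e + p2 * q1] would be a sum of two terms of norm less than
   [nu p1 * nu q2]. *)
have q21 : (nu q2 <= nu q1)%N.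
  rewrite leqNgt; apply/negP => lt12.
  have vq : vnorm q1 q2 = nu q2 by apply/maxn_idPr/ltnW.
  have := nuD e (p2 * q1); rewrite /e subrK -/e !nuM leqNgt gtn_max.
  rewrite vq in area; rewrite area /= (leq_ltn_trans (leq_mul le21 (leqnn _))) //.
  rewrite ltn_pmul2l //; lia.
have -> : vnorm q1 q2 = nu q1 by apply/maxn_idPl.
rewrite -!vnormZ.
(* Scaled by [q1] and [p1], the images of p and q differ by [e] times the second column of the
   matrix; by [large] this difference is too short to affect the norm. *)
have -> : q1 * (a * p1 + b * p2) = p1 * (a * q1 + b * q2) + - (e * b).
  by rewrite /e; ring.
have -> : q1 * (c * p1 + d * p2) = p1 * (c * q1 + d * q2) + - (e * d).
  by rewrite /e; ring.
apply: vnormDr; rewrite vnormN !vnormZ; apply: leq_ltn_trans large.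
by rewrite mulnC leq_mul2r geq_max bD dD orbT.
Qed.

(** Exchanging the two coordinates swaps the columns of the matrix and changes the sign of the area,
    which reduces everything to a dominant first coordinate. *)
Lemma vnorm_mulmx_parallel D a b c d p1 p2 q1 q2 :
  [&& nu a <= D, nu b <= D, nu c <= D & nu d <= D]%N ->
  (nu (p1 * q2 - p2 * q1)%R < vnorm p1 p2 * vnorm q1 q2)%N ->
  (D * nu (p1 * q2 - p2 * q1)%R <
   vnorm p1 p2 * vnorm (a * q1 + b * q2)%R (c * q1 + d * q2)%R)%N ->
  (vnorm q1 q2 * vnorm (a * p1 + b * p2)%R (c * p1 + d * p2)%R =
   vnorm p1 p2 * vnorm (a * q1 + b * q2)%R (c * q1 + d * q2)%R)%N.
Proof.
move=> bound; have [le21|/ltnW le12] := leqP (nu p2) (nu p1).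
  exact: vnorm_mulmx_parallel_aux.
rewrite (vnormC p1) (vnormC q1) -nuN opprB ![a * _ + _]addrC ![c * _ + _]addrC.
apply: vnorm_mulmx_parallel_aux => //.
by case/and4P: bound => -> -> -> ->.
Qed.

(** With s = (a b; c d) and h = (x y; z w), put p = h e2 and q = h (e2 + r e1), so that |p| < |q|.
    If |s q| <= |s p|, then |q| <= D |s q| <= D |s p| <= D^2 |p|, so p is long as well; p and q are
    then nearly parallel and s dilates them equally, a contradiction. *)
Lemma vnorm_mulmx_ltn D a b c d x y z w r :
  [&& nu a <= D, nu b <= D, nu c <= D & nu d <= D]%N ->
  a * d - b * c = 1 -> x * w - y * z = 1 -> (D ^ 4 < nu r)%N ->
  (vnorm y w < vnorm (r * x + y) (r * z + w))%N ->
  (vnorm (a * y + b * w) (c * y + d * w) <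
   vnorm (a * (r * x + y) + b * (r * z + w)) (c * (r * x + y) + d * (r * z + w)))%N.
Proof.
move=> bound dets detB rD lt_pq; rewrite ltnNge; apply/negP => ge_pq.
have D_gt0 : (0 < D)%N.
  rewrite lt0n; apply/eqP => D0; move: bound; rewrite D0 !leqn0 !nu_eq0.
  case/and4P=> /eqP a0 /eqP b0 _ _; move/eqP: dets.
  by rewrite a0 b0 !mul0r subrr eq_sym oner_eq0.
set p1 := y in lt_pq ge_pq; set p2 := w in lt_pq ge_pq.
set q1 := r * x + y in lt_pq ge_pq; set q2 := r * z + w in lt_pq ge_pq.
have area : nu (p1 * q2 - p2 * q1) = nu r.
  rewrite -nuN; congr nu; rewrite /p1 /p2 /q1 /q2.
  by transitivity (r * (x * w - y * z)); [ring | rewrite detB mulr1].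
(* The difference q - p is r h e1, of the same length as q because p is shorter; and h e1 is
   nonzero. *)
have q_ge : (nu r <= vnorm q1 q2)%N.
  have : vnorm (r * x) (r * z) = vnorm q1 q2.
    rewrite -[in RHS](vnormDr (x' := - y) (y' := - w)) ?vnormN //.
    by rewrite /q1 /q2 !addrK.
  move <-; rewrite vnormZ leq_pmulr //.
  rewrite lt0n; apply/eqP => xz0; move/eqP: detB.
  have [/eqP + /eqP] : nu x = 0%N /\ nu z = 0%N by move: xz0; rewrite /vnorm; lia.
  by rewrite !nu_eq0 => /eqP-> /eqP->; rewrite mul0r mulr0 subrr eq_sym oner_eq0.
have sp := vnorm_mulmx_le p1 p2 bound.
(* The inverse matrix is the adjugate, whose entries obey the same bound [D]. *)
have sq : (vnorm q1 q2 <= D * vnorm (a * q1 + b * q2) (c * q1 + d * q2))%N.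
  have bound' : [&& nu d <= D, nu (- b) <= D, nu (- c) <= D & nu a <= D]%N.
    by rewrite !nuN; case/and4P: bound => -> -> -> ->.
  have := vnorm_mulmx_le (a * q1 + b * q2) (c * q1 + d * q2) bound'.
  have -> : d * (a * q1 + b * q2) + - b * (c * q1 + d * q2) = q1.
    by transitivity ((a * d - b * c) * q1); [ring | rewrite dets mul1r].
  have -> // : - c * (a * q1 + b * q2) + a * (c * q1 + d * q2) = q2.
  by transitivity ((a * d - b * c) * q2); [ring | rewrite dets mul1r].
have D2 : (D ^ 4 = D * D * D * D)%N by rewrite !expnS; lia.
move: (vnorm p1 p2) (vnorm q1 q2) lt_pq q_ge sp sq ge_pq
  (@vnorm_mulmx_parallel D a b c d p1 p2 q1 q2 bound).
rewrite area.
move: (vnorm _ _) (vnorm _ _) (nu r) rD => sqn spn n; rewrite D2.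
move=> rD p q lt_pq q_ge sp sq ge_pq par.
have qp : (q <= D * D * p)%N by nia.
(* This fixes the exponent 4: n^2 <= D^2 p q together with D^4 < n yields D^2 n < p q. One factor D
   is lost in passing from q to its image, and another is required by the parallel dilation
   lemma. *)
have pq_large : (n * (D * D) < p * q)%N.
  have : (n * n <= D * D * p * q)%N by apply: leq_mul; lia.
  have : (n * (D * D * D * D) < n * n)%N by rewrite ltn_pmul2l //; lia.
  nia.
have h1 : (n < p * q)%N by apply: leq_ltn_trans pq_large; nia.
have h2 : (D * n < p * sqn)%N.
  have : (p * q <= D * (p * sqn))%N by nia.
  nia.
have := par h1 h2; nia.
Qed.

(** * The subset of SL_2(R) that bounded matrices preserve *)

Local Notation i0 := (0 : 'I_2).
Local Notation i1 := (1 : 'I_2).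

(* Left multiplication by a matrix whose entries are small compared with r
   preserves this property; multiplication by the transvection by - r does not. *)
Definition tilted (r : R) (h : SL 2 R) : bool :=
  (vnorm (val h i0 i1) (val h i1 i1) <
   vnorm (r * val h i0 i0 + val h i0 i1)%R (r * val h i1 i0 + val h i1 i1)%R)%N.

Lemma SL2_det (h : SL 2 R) :
  val h i0 i0 * val h i1 i1 - val h i0 i1 * val h i1 i0 = 1.
Proof. by rewrite -det_mx22; exact/eqP/(valP h). Qed.

Lemma SL2_mulE (g h : SL 2 R) i j :
  val (g * h)%g i j = val g i i0 * val h i0 j + val g i i1 * val h i1 j.
Proof.
rewrite mxE !big_ord_recl big_ord0 addr0.
by congr (_ + val g i _ * val h _ j); apply/val_inj.
Qed.

Lemma tilted_mulr D r (g h : SL 2 R) : (forall i j, nu (val g i j) <= D)%N ->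
  (D ^ 4 < nu r)%N -> tilted r h -> tilted r (g * h)%g.
Proof.
move=> bound rD; rewrite /tilted !SL2_mulE => th.
have b4 : [&& nu (val g i0 i0) <= D, nu (val g i0 i1) <= D,
    nu (val g i1 i0) <= D & nu (val g i1 i1) <= D]%N by rewrite !bound.
have := vnorm_mulmx_ltn b4 (SL2_det g) (SL2_det h) rD th.
by congr (_ < vnorm _ _)%N; ring.
Qed.

Lemma SL2_seq_bounded (s : seq (SL 2 R)) : exists D : nat,
  forall g, g \in s -> forall i j, (nu (val g i j) <= D)%N.
Proof.
elim: s => [|g s [D bound]]; first by exists 0%N.
exists (D + \max_i \max_j nu (val g i j))%N => h; rewrite inE => /orP[/eqP->|hs] i j.
  rewrite (leq_trans _ (leq_addl _ _)) // (bigop.bigmax_sup i) //.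
  by rewrite (bigop.bigmax_sup j).
by rewrite (leq_trans (bound h hs i j)) ?leq_addr.
Qed.

Definition transvection_mx (r : R) : 'M[R]_2 :=
  \matrix_(i, j) (if i == j then 1 else if i == i0 then r else 0).

Lemma det_transvection (r : R) : \det (transvection_mx r) == 1.
Proof. by rewrite det_mx22 !mxE /= mulr0 subr0 mulr1. Qed.

Definition transvection (r : R) : SL 2 R := Sub (transvection_mx r) (det_transvection r).

Lemma SL2_not_finitely_generated (f : R) :
  (1 < nu f)%N -> ~ finitely_generated (SL 2 R).
Proof.
move=> nuf [s gen_s].
(* Bounding the inverses as well lets tiltedness be both preserved and reflected by each
   generator. *)
have [D bound] := SL2_seq_bounded (s ++ [seq g^-1%g | g <- s]).
(* Since [nu f] is at least 2, [nu r] exceeds its exponent. The successor gives [1 < nu r] even when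
   [D] is 0, as the comparison at the identity requires. *)
pose r := f ^+ (D ^ 4).+1.
have rD' : ((D ^ 4).+1 < nu r)%N.
  have -> : nu r = (nu f ^ (D ^ 4).+1)%N.
    by rewrite /r; elim: (D ^ 4).+1 => [|m IH]; rewrite ?nu1 // exprS nuM IH expnS.
  exact: ltn_expl.
have rD := ltnW rD'.
(* The stabilizer of the tilted set; the equivalence makes it closed under inverses. *)
pose H : {pred SL 2 R} := fun h => `[< forall B, tilted r B <-> tilted r (h * B)%g >].
have HH : group_closed H.
  split=> [|g h /asboolP Hg /asboolP Hh]; first by apply/asboolP => B; rewrite mul1g.
  apply/asboolP => B; rewrite -mulgA -Hg.
  by rewrite (Hh (h^-1 * B)%g) mulgA mulgV mul1g.
have sH : {subset s <= H}.
  move=> g gs; apply/asboolP => B; split; apply: contraTT => nt.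
    apply: contraNN nt; apply: tilted_mulr rD.
    by apply: bound; rewrite mem_cat gs.
  apply: contraNN nt => /(tilted_mulr (g := g^-1%g) _ rD); rewrite mulgA mulVg mul1g.
  by apply; apply: bound; rewrite mem_cat map_f ?orbT.
have /asboolP/(_ 1%g) := gen_s H HH sH (transvection (- r)).
rewrite mulg1 /tilted /= !mxE /= !mulr1 mulr0 !add0r addr0 subrr /vnorm.
have -> : nu 0 = 0%N by apply/eqP; rewrite nu_eq0.
by rewrite nuN !nu1; lia.
Qed.

End DiscretelyNormedRing.

(** * The Hilbert basis theorem *)

Definition subring_pred (A : comNzRingType) (P : A -> Prop) : Prop :=
  [/\ P 1, forall x y, P x -> P y -> P (x - y) & forall x y, P x -> P y -> P (x * y)].

Section Span.

Variable A : comNzRingType.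
Implicit Types (P Q : A -> Prop) (s : seq A) (x y : A).

(** The coefficient set is a parameter: the whole ring gives the ideal generated by [s], while a
    local ring or its maximal ideal gives the modules in Nakayama's lemma. *)
Fixpoint in_span P s x : Prop :=
  if s is a :: s' then exists2 c, P c & in_span P s' (x - c * a) else x = 0.

Lemma in_span0 P s : P 0 -> in_span P s 0.
Proof. by move=> P0; elim: s => [|a s IH] //=; exists 0; rewrite // mul0r subr0. Qed.

Lemma in_spanB P s x y : (forall u v, P u -> P v -> P (u - v)) ->
  in_span P s x -> in_span P s y -> in_span P s (x - y).
Proof.
move=> PB; elim: s x y => [|a s IH] x y /=; first by move=> -> ->; rewrite subrr.
move=> [c Pc xc] [d Pd yd]; exists (c - d); first exact: PB.
by have := IH _ _ xc yd; congr in_span; ring.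
Qed.

Lemma in_spanM P Q s u x : (forall c, P c -> Q (u * c)) ->
  in_span P s x -> in_span Q s (u * x).
Proof.
move=> PQ; elim: s x => [|a s IH] x /=; first by move=> ->; rewrite mulr0.
move=> [d Pd xd]; exists (u * d); first exact: PQ.
by rewrite -mulrA -mulrBr; apply: IH.
Qed.

Lemma in_spanN P s x : (forall c, P c -> P (- c)) -> in_span P s x -> in_span P s (- x).
Proof. by move=> PN; rewrite -mulN1r; apply: in_spanM => c; rewrite mulN1r; apply: PN. Qed.

Lemma in_spanD P s x y : P 0 -> (forall u v, P u -> P v -> P (u - v)) ->
  in_span P s x -> in_span P s y -> in_span P s (x + y).
Proof.
move=> P0 PB xs ys; rewrite -[y]opprK; apply: in_spanB => //.
by apply: in_spanN ys => c Pc; rewrite -sub0r; apply: PB.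
Qed.

Lemma in_span_mem P s x : P 0 -> P 1 -> x \in s -> in_span P s x.
Proof.
move=> P0 P1; elim: s => [|a s IH] //=; rewrite inE => /orP[/eqP->|xs].
  by exists 1; rewrite // mul1r subrr; apply: in_span0.
by exists 0; rewrite // mul0r subr0; apply: IH.
Qed.

Lemma in_span_sub (P Q : A -> Prop) s x : Q 0 ->
  (forall u v, Q u -> Q v -> Q (u - v)) ->
  (forall c y, P c -> y \in s -> Q (c * y)) -> in_span P s x -> Q x.
Proof.
move=> Q0 QB; elim: s x => [|a s IH] x sQ /=; first by move=> ->.
move=> [c Pc xc].
have -> : x = (x - c * a) - (0 - c * a) by rewrite sub0r opprK subrK.
apply: (QB); first by apply: IH xc => d y Pd ys; apply: sQ; rewrite // inE ys orbT.
by apply: QB => //; apply: sQ; rewrite // inE eqxx.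
Qed.

End Span.

Section IdealSpan.

Variable A : comNzRingType.
Implicit Types (s : seq A) (x y : A).

Definition in_ideal s x : Prop := in_span (fun=> True) s x.

Lemma in_ideal0 s : in_ideal s 0.
Proof. exact: in_span0. Qed.

Lemma in_idealB s x y : in_ideal s x -> in_ideal s y -> in_ideal s (x - y).
Proof. exact: in_spanB. Qed.

Lemma in_idealD s x y : in_ideal s x -> in_ideal s y -> in_ideal s (x + y).
Proof. exact: in_spanD. Qed.

Lemma in_ideal_mem s x : x \in s -> in_ideal s x.
Proof. exact: in_span_mem. Qed.

Lemma in_ideal_trans s s' x :
  (forall y, y \in s -> in_ideal s' y) -> in_ideal s x -> in_ideal s' x.
Proof.
move=> ss'; apply: (in_span_sub (in_ideal0 _) (@in_idealB _)) => c y _ ys.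
by apply: in_spanM (ss' _ ys).
Qed.

End IdealSpan.

(** A sequential form of the ascending chain condition, which avoids quantifying over ideals. *)
Definition noetherian (A : comNzRingType) : Prop :=
  forall p : nat -> A, exists n, in_ideal (mkseq p n) (p n).

Lemma noetherian_field (F : fieldType) : noetherian F.
Proof.
move=> p; have [p0|p0] := eqVneq (p 0%N) 0; first by exists 0%N.
by exists 1%N, (p 1%N / p 0%N) => //=; rewrite divfK // subrr.
Qed.

Section HilbertBasis.

Variable A : comNzRingType.
Implicit Types (s : seq {poly A}) (f g : {poly A}).

(** A combination of leading coefficients lifts to polynomials once each [q] is multiplied by a
    power of X that moves its leading term to degree [d.-1]. *)
Lemma in_span_lead_coef s d x : (forall q, q \in s -> 0 < size q <= d)%N ->
  in_ideal (map lead_coef s) x ->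
  exists g, [/\ in_ideal s g, (size g <= d)%N & g`_d.-1 = x].
Proof.
elim: s x => [|q s IH] x sz /=.
  by move=> ->; exists 0; rewrite size_poly0 coef0.
have /andP[q_gt0 qd] := sz q (mem_head _ _).
have {}sz u : u \in s -> (0 < size u <= d)%N by move=> us; rewrite sz // inE us orbT.
move=> [c _ /(IH _ sz)[g [gs gd gx]]].
exists (g + c%:P * 'X^(d - size q) * q); split.
- by exists (c%:P * 'X^(d - size q)); rewrite //= addrK.
- rewrite (leq_trans (size_polyD _ _)) // geq_max gd /=.
  rewrite -mulrA mul_polyC (leq_trans (size_scale_leq _ _)) //.
  rewrite (leq_trans (size_polyMleq _ _)) // size_polyXn addSn /=.
  by rewrite subnK.
- rewrite coefD gx -mulrA coefCM coefXnM.
  have -> : (d.-1 < d - size q)%N = false by lia.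
  have -> : (d.-1 - (d - size q) = (size q).-1)%N by lia.
  by rewrite /lead_coef subrK.
Qed.

(** Hilbert's argument. In the union [I] of the ideals generated by initial segments of a bad
    sequence, choose each [f n] of least size outside the ideal of its predecessors. A relation
    among leading coefficients in [A] cancels the top term of some [f n] and contradicts
    minimality. *)
Lemma noetherian_poly : noetherian A -> noetherian {poly A}.
Proof.
move=> noethA p; apply: contrapT => /forallNP bad.
pose I f := exists n, in_ideal (mkseq p n) f.
have mono n m f : (n <= m)%N -> in_ideal (mkseq p n) f -> in_ideal (mkseq p m) f.
  move=> nm; apply: in_ideal_trans => _ /mapP[i + ->]; rewrite mem_iota /= => i_lt.
  by apply/in_ideal_mem/map_f; rewrite mem_iota /=; lia.
have IB f g : I f -> I g -> I (f - g).
  move=> [n fn] [m gm]; exists (maxn n m); apply: in_idealB.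
    by apply: mono fn; rewrite leq_maxl.
  by apply: mono gm; rewrite leq_maxr.
have common s : (forall q, q \in s -> I q) ->
    exists n, forall q, q \in s -> in_ideal (mkseq p n) q.
  elim: s => [|q s IH] sI; first by exists 0%N.
  have [u us|n sn] := IH; first by apply: sI; rewrite inE us orbT.
  have [m qm] := sI q (mem_head _ _).
  exists (maxn n m) => u; rewrite inE => /orP[/eqP->|/sn].
    by apply: mono qm; rewrite leq_maxr.
  by apply: mono; rewrite leq_maxl.
have Ispan s f : (forall q, q \in s -> I q) -> in_ideal s f -> I f.
  by move=> /common[n sn] fs; exists n; apply: in_ideal_trans fs.
have next s : exists f, (forall q, q \in s -> I q) ->
    [/\ I f, ~ in_ideal s f & forall g, I g -> ~ in_ideal s g -> (size f <= size g)%N].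
  have [sI|] := pselect (forall q, q \in s -> I q); last by exists 0.
  have ex : exists d, `[< exists f, [/\ I f, ~ in_ideal s f & size f = d] >].
    have [n sn] := common s sI.
    exists (size (p n)); apply/asboolP; exists (p n); split=> //.
      by exists n.+1; apply/in_ideal_mem/map_f; rewrite mem_iota /=; lia.
    by move=> pn; apply: (bad n); apply: in_ideal_trans pn.
  have [d /asboolP[f [fI fs fd]] dmin] := find_ex_minn ex.
  exists f => _; split=> // g gI gs; rewrite fd; apply: dmin.
  by apply/asboolP; exists g.
have [F FP] := choice next.
pose L := fix L n := if n is n'.+1 then rcons (L n') (F (L n')) else [::].
pose f n := F (L n).
have LE n : L n = mkseq f n by elim: n => [|n IH] //=; rewrite mkseqS -IH.
have LI n q : q \in L n -> I q.
  elim: n q => [|n IH] q //=; rewrite mem_rcons inE => /orP[/eqP->|]; last exact: IH.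
  by have [] := FP _ IH.
have [n] := noethA (fun n => lead_coef (f n)).
have -> : mkseq (fun n => lead_coef (f n)) n = map lead_coef (L n).
  by rewrite LE /mkseq -map_comp.
have [fI fL fmin] := FP _ (LI n).
move/(in_span_lead_coef (d := size (f n))) => [q|g [gL gsz glc]].
  rewrite LE => /mapP[i + ->]; rewrite mem_iota add0n => /= i_lt.
  (* [f n] was already a candidate at stage [i], so minimality makes [f i] no larger. *)
  have [iI iL imin] := FP _ (LI i); apply/andP; split.
    rewrite lt0n size_poly_eq0; apply/eqP => fi0; apply: iL.
    by rewrite -/(f i) fi0; apply: in_ideal0.
  apply: imin => // fLi; apply: fL; apply: in_ideal_trans fLi => u.
  rewrite !LE => /mapP[j + ->]; rewrite mem_iota /= => j_lt.
  by apply/in_ideal_mem/map_f; rewrite mem_iota /=; lia.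
have fg_I : I (f n - g) by apply: IB => //; apply: Ispan gL; apply: LI.
have fgL : ~ in_ideal (L n) (f n - g).
  by move=> fg; apply: fL; rewrite -/(f n) -(subrK g (f n)); apply: in_idealD.
have := fmin _ fg_I fgL; rewrite leqNgt -/(f n) => /negP; apply.
have f_gt0 : (0 < size (f n))%N.
  rewrite lt0n size_poly_eq0; apply/eqP => f0; apply: fL.
  by rewrite -/(f n) f0; apply: in_ideal0.
rewrite -(prednK f_gt0) ltnS; apply/leq_sizeP => j.
rewrite leq_eqVlt => /orP[/eqP<-|jlt]; first by rewrite coefB glc subrr.
have fj : (size (f n) <= j)%N by rewrite -(prednK f_gt0).
by rewrite coefB !nth_default ?subrr // (leq_trans gsz).
Qed.

End HilbertBasis.

(** An iterated polynomial ring, with one variable for each member of [z], is mapped onto the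
    subring generated by [z] over the constants; the last clause says that the image is no
    larger. *)
Lemma noetherian_adjoin (F : fieldType) (B : comNzRingType)
    (i : {rmorphism F -> B}) (z : seq B) :
  exists (A : comNzRingType) (e : {rmorphism A -> B}),
    [/\ noetherian A, forall c, exists a, e a = i c,
        forall x, x \in z -> exists a, e a = x
      & forall P, subring_pred P -> (forall c, P (i c)) ->
          (forall x, x \in z -> P x) -> forall a, P (e a)].
Proof.
elim: z => [|x z [A [e [noethA ei ez esub]]]].
  by exists F, i; split=> //; [exact: noetherian_field|move=> c; exists c].
exists {poly A}, (horner_eval x \o map_poly e); split.
- exact: noetherian_poly.
- by move=> c; have [a <-] := ei c; exists a%:P; rewrite /= map_polyC /horner_eval hornerC.
- move=> y; rewrite inE => /orP[/eqP->|/ez[a <-]].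
    by exists 'X; rewrite /= map_polyX /horner_eval hornerX.
  by exists a%:P; rewrite /= map_polyC /horner_eval hornerC.
- move=> P PP Pi Pz a; have [P1 PB PM] := PP; have Pe : forall a, P (e a).
    by apply: esub => // y yz; apply: Pz; rewrite inE yz orbT.
  elim/poly_ind: a => [|q c IH]; first by rewrite rmorph0 -(subrr 1); apply: PB.
  have := PB _ _ (PM _ _ IH (Pz x (mem_head _ _))) (Pe (- c)); congr P.
  rewrite rmorphD rmorphM /= map_polyX map_polyC /horner_eval hornerX hornerC.
  by rewrite rmorphN opprK.
Qed.

(** * Places *)

Section Places.

Variables (K : fieldType) (k : closedFieldType) (i : {rmorphism k -> K}).
Implicit Types (V : set (K * k)) (P : {poly K * k}) (a : K) (b c : k).

(* V is the graph of a ring morphism to k, fixing k, from a subring of K. *)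
Definition place_graph V : Prop :=
  [/\ forall c, V (i c, c), forall x y, V x -> V y -> V (x - y),
      forall x y, V x -> V y -> V (x * y) & forall b, V (0, b) -> b = 0].

Definition coefs_in V P : Prop := forall j, V P`_j.

Lemma map_fstE P n a : (size P <= n)%N ->
  (map_poly fst P).[a] = \sum_(j < n) (P`_j).1 * a ^+ j.
Proof.
move=> Pn; rewrite (horner_coef_wide _ (leq_trans (size_poly _ _) Pn)).
by apply: eq_bigr => j _; rewrite coef_map.
Qed.

Section Graph.

Variable V : set (K * k).
Hypothesis VP : place_graph V.

Lemma place_graph0 : V 0.
Proof. by have [/(_ 0) + _ _ _] := VP; rewrite rmorph0. Qed.

Lemma place_graph1 : V 1.
Proof. by have [/(_ 1) + _ _ _] := VP; rewrite rmorph1. Qed.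

Lemma place_graphB x y : V x -> V y -> V (x - y).
Proof. by have [_ + _ _] := VP; apply. Qed.

Lemma place_graphM x y : V x -> V y -> V (x * y).
Proof. by have [_ _ + _] := VP; apply. Qed.

Lemma place_graphD x y : V x -> V y -> V (x + y).
Proof.
move=> Vx Vy; rewrite -[y]opprK -[- y]add0r; apply: place_graphB => //.
by apply: place_graphB => //; apply: place_graph0.
Qed.

Lemma place_graphX x m : V x -> V (x ^+ m).
Proof.
move=> Vx; elim: m => [|m IH]; first exact: place_graph1.
by rewrite exprS; apply: place_graphM.
Qed.

Lemma place_graph_sum (I : Type) (r : seq I) (E : I -> K * k) :
  (forall j, V (E j)) -> V (\sum_(j <- r) E j).
Proof.
by move=> VE; elim/big_rec: _ => [|j x _]; [exact: place_graph0|exact: place_graphD].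
Qed.

Lemma coefs_inC x : V x -> coefs_in V x%:P.
Proof. by move=> Vx j; rewrite coefC; case: ifP => // _; apply: place_graph0. Qed.

Lemma coefs_inX : coefs_in V 'X.
Proof.
by move=> j; rewrite coefX; case: (j == _); [exact: place_graph1|exact: place_graph0].
Qed.

Lemma coefs_inB P Q : coefs_in V P -> coefs_in V Q -> coefs_in V (P - Q).
Proof. by move=> VP' VQ j; rewrite coefB; apply: place_graphB. Qed.

Lemma coefs_inM P Q : coefs_in V P -> coefs_in V Q -> coefs_in V (P * Q).
Proof.
by move=> VP' VQ j; rewrite coefM; apply: place_graph_sum => l; apply: place_graphM.
Qed.

Hypothesis Vmax : forall W, place_graph W -> V `<=` W -> W `<=` V.

(** The hypothesis says that adjoining the pair to [V] keeps the graph single-valued, so maximality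
    puts the pair in [V]. *)
Lemma place_graph_extend a b :
  (forall P, coefs_in V P -> (map_poly fst P).[a] = 0 -> (map_poly snd P).[b] = 0) ->
  V (a, b).
Proof.
move=> ab; pose W := [set P.[(a, b)] | P in coefs_in V].
have hornerE2 P : P.[(a, b)] = ((map_poly fst P).[a], (map_poly snd P).[b]).
  by rewrite -[a]/((a, b).1) -[b in RHS]/((a, b).2) !horner_map; case: (P.[_]).
have VW : V `<=` W by move=> x Vx; exists x%:P; rewrite ?hornerC //; apply: coefs_inC.
apply: (Vmax (W := W)) => //; last by exists 'X; rewrite ?hornerX //; apply: coefs_inX.
split.
- by move=> c; apply: VW; have [+ _ _ _] := VP; apply.
- move=> _ _ [P VP' <-] [Q VQ <-]; exists (P - Q); first exact: coefs_inB.
  by rewrite hornerD hornerN.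
- move=> _ _ [P VP' <-] [Q VQ <-]; exists (P * Q); first exact: coefs_inM.
  by rewrite hornerM.
- by move=> c [P VP']; rewrite hornerE2 => -[/(ab _ VP') -> <-].
Qed.

(** The domain of a maximal place is local. A relation for the inverse of [a], multiplied by a high
    enough power of [a], becomes an element of [V] over 0, whose value must vanish. *)
Lemma place_graphV a b : V (a, b) -> b != 0 -> V (a^-1, b^-1).
Proof.
move=> Vab b0; have Vinj : forall c, V (0, c) -> c = 0 by have [] := VP.
have a0 : a != 0 by apply: contraNneq b0 => a0; rewrite a0 in Vab; rewrite (Vinj _ Vab).
apply: place_graph_extend => P VP' Pa.
have E : (a, b) ^+ size P * P.[(a^-1, b^-1)] =
    \sum_(j < size P) P`_j * (a, b) ^+ (size P - j).
  rewrite horner_coef mulr_sumr; apply: eq_bigr => j _.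
  rewrite mulrCA; congr (_ * _).
  rewrite -{1}(subnK (ltnW (ltn_ord j))) exprD -mulrA -exprMn.
  have -> : (a, b) * (a^-1, b^-1) = 1.
    by rewrite -[LHS]/(a / a, b / b) !divff.
  by rewrite expr1n mulr1.
have : V ((a, b) ^+ size P * P.[(a^-1, b^-1)]).
  rewrite E; apply: place_graph_sum => j; apply: place_graphM => //.
  exact: place_graphX.
have -> : P.[(a^-1, b^-1)] = (0, (map_poly snd P).[b^-1]).
  rewrite -Pa -[a^-1 in RHS]/((a^-1, b^-1).1) -[b^-1 in RHS]/((a^-1, b^-1).2).
  by rewrite !horner_map; case: (P.[_]).
have -> c : (a, b) ^+ size P * (0, c) = (0, b ^+ size P * c).
  have -> : (a, b) ^+ size P = (a ^+ size P, b ^+ size P).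
    by elim: (size P) => [|m IH] //; rewrite !exprS IH.
  by rewrite -[LHS]/(_ * 0, _ * _) mulr0.
by move/Vinj/eqP; rewrite mulf_eq0 expf_eq0 (negPf b0) andbF => /eqP.
Qed.

(** Relations satisfied by [a] over [V] reduce to an ideal of k[X]. If that ideal is proper, a root
    of its generator is an admissible value for [a], as k is algebraically closed; otherwise it
    contains 1. *)
Lemma place_graph_dom_or_unit_relation a :
  (exists b, V (a, b)) \/
  (exists P, [/\ coefs_in V P, (map_poly fst P).[a] = 0 & map_poly snd P = 1]).
Proof.
have [|nodom] := pselect (exists b, V (a, b)); first by left.
right; pose I (q : {poly k}) :=
  exists P, [/\ coefs_in V P, (map_poly fst P).[a] = 0 & map_poly snd P = q].
have IB q r : I q -> I r -> I (q - r).
  move=> [P [VP1 Pa <-]] [Q [VQ Qa <-]]; exists (P - Q); split.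
  - exact: coefs_inB.
  - by rewrite rmorphB hornerD hornerN Pa Qa subrr.
  - by rewrite rmorphB.
have IM q r : I r -> I (q * r).
  move=> [P [VP1 Pa <-]]; pose Q := \poly_(j < size q) ((i q`_j, q`_j) : K * k).
  have VQ : coefs_in V Q.
    move=> j; rewrite coef_poly; case: ifP => _; last exact: place_graph0.
    by have [+ _ _ _] := VP; apply.
  have Qq : map_poly snd Q = q.
    apply/polyP => j; rewrite coef_map coef_poly; case: ltnP => //= qj.
    by rewrite nth_default.
  exists (Q * P); split; first exact: coefs_inM.
    by rewrite rmorphM hornerM Pa mulr0.
  by rewrite rmorphM /= Qq.
have Ib b : exists2 q, I q & q.[b] != 0.
  apply: contrapT => nq; apply: nodom; exists b; apply: place_graph_extend => P VP1 Pa.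
  apply/eqP; apply: contrapT => /negP Pb; apply: nq; exists (map_poly snd P) => //.
  by exists P.
have ex : exists d, `[< exists q, [/\ I q, q != 0 & size q = d] >].
  have [q Iq q0] := Ib 0; exists (size q); apply/asboolP; exists q; split=> //.
  by apply: contraNneq q0 => ->; rewrite horner0.
have [d /asboolP[h [Ih h0 hd]] dmin] := find_ex_minn ex.
have [sz1|szN1] := eqVneq (size h) 1%N.
  have [c c0 hc] : exists2 c, c != 0 & h = c%:P by apply/size_poly1P/eqP.
  by have := IM (c^-1)%:P h Ih; rewrite hc -polyCM mulVf.
have /closed_rootP[b hb] := szN1.
have [q Iq /negP[]] := Ib b.
suff /eqP qh : q %% h == 0.
  by rewrite (Pdiv.Field.divp_eq q h) qh addr0 hornerM (rootP hb) mulr0.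
apply: contrapT => /negP r0; have : (d <= size (q %% h)%R)%N.
  apply/dmin/asboolP; exists (q %% h); split=> //.
  have -> : q %% h = q - (q %/ h)%R * h.
    by rewrite {2}(Pdiv.Field.divp_eq q h) addrAC subrr add0r.
  by apply: IB => //; apply: IM.
by rewrite leqNgt -hd ltn_modp h0.
Qed.

(** The constant coefficient has value 1 and the others value 0: the maximal ideal of the place
    generates the unit ideal after [a] is adjoined, with a witness of degree at most [n]. *)
Definition unit_relation a n : Prop := exists P,
  [/\ coefs_in V P, (size P <= n.+1)%N, (map_poly fst P).[a] = 0 & map_poly snd P = 1].

(** The constant coefficient of the relation for the inverse of [a] is a unit, so that relation
    expresses [a ^+ n.+1] through lower powers; substitution removes the top term. *)
Lemma unit_relation_reduce a m n : a != 0 -> (m <= n.+1)%N ->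
  unit_relation a n.+1 -> unit_relation a^-1 m -> unit_relation a n.
Proof.
move=> a0 mn [P [VP1 szP Pa P1]] [Q [VQ szQ Qa Q1]].
have P1j j : (P`_j).2 = (j == 0%N)%:R.
  by have := congr1 (fun p : {poly k} => p`_j) P1; rewrite coef_map coef1.
have Q1j j : (Q`_j).2 = (j == 0%N)%:R.
  by have := congr1 (fun p : {poly k} => p`_j) Q1; rewrite coef_map coef1.
have Vw : V ((Q`_0).1^-1, 1).
  rewrite -[1]invr1; apply: place_graphV; last exact: oner_neq0.
  by have := VQ 0%N; rewrite [Q`_0]surjective_pairing Q1j.
have q00 : (Q`_0).1 != 0.
  apply/eqP => q00; have := VQ 0%N; rewrite [Q`_0]surjective_pairing Q1j q00.
  by have [_ _ _ /[apply] /eqP] := VP; rewrite oner_eq0.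
set w := (_, _) in Vw.
pose P' j := P`_j - P`_n.+1 * w * Q`_(n.+1 - j).
exists (\poly_(j < n.+1) P' j); split.
- move=> j; rewrite coef_poly; case: ifP => _; last exact: place_graph0.
  by apply: place_graphB => //; apply: place_graphM => //; apply: place_graphM.
- exact: size_poly.
- rewrite (map_fstE a (size_poly _ _)).
  transitivity (\sum_(j < n.+2) (P' j).1 * a ^+ j).
    have P'n : (P' n.+1).1 = 0.
      by rewrite /P' subnn /= -mulrA mulVf // mulr1 subrr.
    rewrite [RHS]big_ord_recr [(P' (nat_of_ord ord_max)).1]P'n mul0r /= addr0.
    by apply: eq_bigr => j _; rewrite coef_poly ltn_ord.
  under eq_bigr do rewrite /P' /= mulrBl.
  rewrite sumrB -(map_fstE a szP) Pa sub0r; apply/eqP; rewrite oppr_eq0; apply/eqP.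
  have Qa' : \sum_(j < n.+2) (Q`_j).1 * a^-1 ^+ j = 0.
    by rewrite -map_fstE // (leq_trans szQ).
  transitivity ((P`_n.+1).1 * (Q`_0).1^-1 * a ^+ n.+1 *
      \sum_(j < n.+2) (Q`_j).1 * a^-1 ^+ j); last by rewrite Qa' mulr0.
  rewrite mulr_sumr (reindex_inj rev_ord_inj); apply: eq_bigr => j _ /=.
  have jn : (j <= n.+1)%N by rewrite -ltnS.
  rewrite subSS subKn // -!mulrA; congr (_ * (_ * _)).
  rewrite mulrCA; congr (_ * _).
  have -> : a ^+ n.+1 = a ^+ (n.+1 - j) * a ^+ j by rewrite -exprD subnK.
  by rewrite -mulrA -exprMn divff // expr1n mulr1.
- apply/polyP => j; rewrite coef_map coef_poly coef1.
  have [jn|nj] := ltnP; last by case: j nj.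
  by rewrite /P' /= !P1j /= !mul0r subr0.
Qed.

(** If neither [a] nor its inverse has a value, take unit relations of least degree for both; the
    one of smaller degree shortens the other. Degree 0 is excluded, since it would give 1 the value
    0. *)
Lemma place_graph_total a : (exists b, V (a, b)) \/ (exists b, V (a^-1, b)).
Proof.
have [->|a0] := eqVneq a 0; first by left; exists 0; exact: place_graph0.
have relE x P : coefs_in V P -> (map_poly fst P).[x] = 0 -> map_poly snd P = 1 ->
    exists n, `[< unit_relation x n >].
  by move=> VP1 Px P1; exists (size P); apply/asboolP; exists P; split=> //; apply: leqW.
have [|[P [VP1 Pa P1]]] := place_graph_dom_or_unit_relation a; first by left.
have [|[Q [VQ Qa Q1]]] := place_graph_dom_or_unit_relation a^-1; first by right.
exfalso.
have [n /asboolP reln nmin] := find_ex_minn (relE _ _ VP1 Pa P1).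
have [m /asboolP relm mmin] := find_ex_minn (relE _ _ VQ Qa Q1).
have pos x l : unit_relation x l -> l = 0%N -> False.
  move=> [S [VS szS Sx S1]] l0; have S00 := VS 0%N; move: S00.
  rewrite [S`_0]surjective_pairing.
  have -> : (S`_0).2 = 1.
    by have := congr1 (fun p : {poly k} => p`_0) S1; rewrite coef_map coef1.
  have -> : (S`_0).1 = 0.
    by move: Sx; rewrite (map_fstE x szS) l0 big_ord1 mulr1.
  by have [_ _ _ /[apply] /eqP] := VP; rewrite oner_eq0.
have [mn|/ltnW nm] := leqP m n.
  case: n reln nmin mn => [/pos/(_ erefl) //|n] reln nmin mn.
  have /asboolP/nmin := unit_relation_reduce a0 mn reln relm.
  by rewrite ltnn.
case: m relm mmin nm => [/pos/(_ erefl) //|m] relm mmin nm.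
rewrite -[a]invrK in reln; have a0' : a^-1 != 0 by rewrite invr_eq0.
have /asboolP/mmin := unit_relation_reduce a0' nm relm reln.
by rewrite ltnn.
Qed.

End Graph.

(** A nonconstant [g] is transcendental, since polynomials over k split into linear factors; hence
    p(g) determines p(0). *)
Lemma place_graph_transcendental g : (forall c, g <> i c) ->
  place_graph [set ((map_poly i p).[g], p.[0]) | p in [set: {poly k}]].
Proof.
move=> gk; split.
- by move=> c; exists c%:P; rewrite // map_polyC !hornerC.
- move=> _ _ [p _ <-] [q _ <-]; exists (p - q) => //.
  by rewrite rmorphB !hornerD !hornerN.
- move=> _ _ [p _ <-] [q _ <-]; exists (p * q) => //.
  by rewrite rmorphM !hornerM.
move=> b [p _ [pg <-]]; suff -> : p = 0 by rewrite horner0.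
apply/eqP; apply: contrapT => /negP p0; move: pg.
have [r ->] := closed_field_poly_normal p.
rewrite map_polyZ hornerZ rmorph_prod horner_prod => /eqP.
rewrite mulf_eq0 fmorph_eq0 lead_coef_eq0 (negPf p0) /=.
rewrite prodf_seq_eq0 => /hasP[z _ /=].
rewrite map_polyXsubC hornerXsubC subr_eq0 => /eqP; exact: gk.
Qed.

(* Chevalley's extension theorem for the specialization g = 0. *)
Lemma place_exists g : (forall c, g <> i c) -> exists V,
  [/\ place_graph V, forall W, place_graph W -> V `<=` W -> W `<=` V & V (g, 0)].
Proof.
move=> gk; set V0 := [set ((map_poly i p).[g], p.[0]) | p in [set: {poly k}]].
have V0P : place_graph V0 by exact: place_graph_transcendental.
pose good V := V = set0 \/ (place_graph V /\ V0 `<=` V).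
have [F Fgood Ftot|V [Vgood Vmax]] := @Zorn_bigcup _ good.
  have [->|/set0P[x [X FX Xx]]] := eqVneq (\bigcup_(X in F) X) set0; first by left.
  have goodX Y y : F Y -> Y y -> place_graph Y /\ V0 `<=` Y.
    by move=> FY Yy; have [Y0|//] := Fgood _ FY; rewrite Y0 in Yy.
  have [XP V0X] := goodX _ _ FX Xx; right; split; last first.
    by move=> y /V0X Xy; exists X.
  have both y z : (\bigcup_(X in F) X) y -> (\bigcup_(X in F) X) z ->
      exists Y, [/\ F Y, place_graph Y, Y y & Y z].
    move=> [Y FY Yy] [Z FZ Zz]; have [YZ|ZY] := Ftot _ _ FY FZ.
      by exists Z; split=> //; [have [] := goodX _ _ FZ Zz|exact: YZ].
    by exists Y; split=> //; [have [] := goodX _ _ FY Yy|exact: ZY].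
  split.
  - by move=> c; exists X => //; have [+ _ _ _] := XP; apply.
  - move=> y z Uy Uz; have [Y [FY YP Yy Yz]] := both _ _ Uy Uz.
    by exists Y => //; apply: place_graphB.
  - move=> y z Uy Uz; have [Y [FY YP Yy Yz]] := both _ _ Uy Uz.
    by exists Y => //; apply: place_graphM.
  - by move=> b [Y FY Yb]; have [[_ _ _ +] _] := goodX _ _ FY Yb; apply.
have [V_0|[VP V0V]] := Vgood.
  exfalso; apply: (Vmax V0); last by right; split.
  rewrite V_0; split=> // sub; apply: (sub (g, 0)).
  by exists 'X; rewrite // map_polyX !hornerX.
exists V; split=> //.
- move=> W WP VW x Wx; apply: contrapT => nVx; apply: (Vmax W).
    by split=> // WV; apply/nVx/WV.
  by right; split=> // y /V0V/VW.
- by apply: V0V; exists 'X; rewrite // map_polyX !hornerX.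
Qed.

End Places.

(** * Rational functions and their values *)

Lemma mpoly_ring_ind (n : nat) (R : comNzRingType) (P : {mpoly R[n]} -> Prop) :
  (forall c, P c%:MP) -> (forall i, P 'X_i) ->
  (forall p q, P p -> P q -> P (p + q)) -> (forall p q, P p -> P q -> P (p * q)) ->
  forall p, P p.
Proof.
move=> PC PX PD PM; elim/mpolyind => [|c m p _ _ Pp]; first exact: PC.
apply: PD => //; rewrite -mul_mpolyC; apply: (PM) => //; rewrite mpolyXE_id.
apply: (big_ind P) => [|p' q'|i _]; [exact: PC|exact: PM|].
by elim: (m i) => [|d IH]; [exact: PC|rewrite exprS; apply: PM].
Qed.

Lemma mmap_homog_scale (n : nat) (R S : comNzRingType) (f : R -> S) (h : 'I_n -> S)
    (u : S) d (F : {mpoly R[n]}) : F \is d.-homog ->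
  mmap f (fun i => u * h i) F = u ^+ d * mmap f h F.
Proof.
move=> /dhomogP hF; rewrite /mmap mulr_sumr !big_seq; apply: eq_bigr => m mF.
rewrite mulrCA; congr (_ * _); rewrite /mmap1.
under eq_bigr do rewrite exprMn.
rewrite big_split /=; congr (_ * _).
have -> : d = (\sum_i m i)%N by rewrite -(hF m mF) -mdegE.
by elim/big_rec2: _ => // i y z _ ->; rewrite exprD.
Qed.

Lemma meval_homog_scale (n : nat) (R : comNzRingType) (v : 'I_n -> R) (u : R) d
    (F : {mpoly R[n]}) : F \is d.-homog ->
  F.@[fun i => u * v i] = u ^+ d * F.@[v].
Proof. exact: mmap_homog_scale. Qed.

Lemma dhomog_var n (R : nzRingType) (i : 'I_n) : ('X_i : {mpoly R[n]}) \is 1.-homog.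
Proof. by rewrite dhomogX; apply/eqP/mdeg1. Qed.

Section Values.

Variables (k : closedFieldType) (n : nat) (C : smooth_projective_curve k n).
Local Notation K := (function_field C).
Local Notation form := {mpoly k[n.+1]}.
Implicit Types (x y : pspace k n) (f g : K) (c d : k) (F G H : form).

Lemma ff_const_is_zmod_morphism : zmod_morphism (@ff_const k n C).
Proof.
move=> c d; rewrite -[RHS]/(ff_add (ff_const C c) (ff_opp (ff_const C d))).
rewrite /ff_const ff_oppE ff_addE; apply/ratfunP => y Cy.
by rewrite !rf_opE !form_atE; ring.
Qed.

Lemma ff_const_is_monoid_morphism : monoid_morphism (@ff_const k n C).
Proof.
split=> // c d; rewrite -[RHS]/(ff_mul (ff_const C c) (ff_const C d)).
rewrite /ff_const ff_mulE; apply/ratfunP => y Cy.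
by rewrite !rf_opE !form_atE; ring.
Qed.

HB.instance Definition _ :=
  GRing.isZmodMorphism.Build k K (@ff_const k n C) ff_const_is_zmod_morphism.
HB.instance Definition _ :=
  GRing.isMonoidMorphism.Build k K (@ff_const k n C) ff_const_is_monoid_morphism.

(** A relation, because [f] may have a pole at [y] and has many representatives. *)
Definition is_val y f c : Prop :=
  exists2 r : ratfun_rep C, f = \pi_K r &
    form_at (rf_den r) y != 0 /\ form_at (rf_num r) y = c * form_at (rf_den r) y.

Lemma regular_atP y f : regular_at y f <-> exists c, is_val y f c.
Proof.
split=> [[r fr den]|[c [r fr [den _]]]]; last by exists r.
by exists (form_at (rf_num r) y / form_at (rf_den r) y), r; rewrite // divfK.
Qed.

Lemma vanishes_atP y f : vanishes_at y f <-> is_val y f 0.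
Proof. by split=> -[r fr [den num]]; exists r; rewrite // mul0r in num *. Qed.

Lemma is_val_const y c : is_val y (ff_const C c) c.
Proof. by exists (rf_const C c); rewrite // !rf_opE !form_atE mulr1 oner_neq0. Qed.

Lemma is_valB y f g c d : is_val y f c -> is_val y g d -> is_val y (f - g) (c - d).
Proof.
move=> [r -> [rd rn]] [s -> [sd sn]]; exists (rf_add r (rf_opp s)).
  by rewrite -[LHS]/(ff_add _ (ff_opp _)) ff_oppE ff_addE.
by rewrite !rf_opE !form_atE mulf_neq0 // rn sn; split=> //; ring.
Qed.

Lemma is_valM y f g c d : is_val y f c -> is_val y g d -> is_val y (f * g) (c * d).
Proof.
move=> [r -> [rd rn]] [s -> [sd sn]]; exists (rf_mul r s).
  by rewrite -[LHS]/(ff_mul _ _) ff_mulE.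
by rewrite !rf_opE !form_atE mulf_neq0 // rn sn; split=> //; ring.
Qed.

Lemma is_valD y f g c d : is_val y f c -> is_val y g d -> is_val y (f + g) (c + d).
Proof.
move=> fc gd; have := is_valB fc (is_valB (is_val_const y 0) gd).
by rewrite rmorph0 !sub0r !opprK.
Qed.

Lemma is_val_uniq y f c d : on_curve C y -> is_val y f c -> is_val y f d -> c = d.
Proof.
move=> Cy [r -> [rd rn]] [s /ratfunP/(_ y Cy) E [sd sn]]; move: E.
rewrite rn sn mulrAC => /(mulIf rd)/(mulIf sd) //.
Qed.

Lemma is_valV y f c : on_curve C y -> c != 0 -> is_val y f c -> is_val y f^-1 c^-1.
Proof.
move=> Cy c0 [r -> [rd rn]].
have num0 : form_at (rf_num r) y != 0 by rewrite rn mulf_neq0.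
have nz : nonzero_on C (rf_num r) by apply/asboolP; exists y.
exists (mk_ratfun (rf_den_homog r) (rf_num_homog r) nz).
  apply/(mulfI (x := \pi_K r)); last rewrite mulfV.
  - apply/eqP => /ff_eq0; rewrite nz //.
  - rewrite -[RHS]/(ff_mul _ _) ff_mulE; apply/ratfunP => z Cz.
    by rewrite !rf_opE !form_atE; ring.
  - by apply/eqP => /ff_eq0; rewrite nz.
by rewrite !rf_opE rn mulrA mulVf // mul1r mulf_neq0.
Qed.

(** By irreducibility, the numerator of a nonzero difference is nonzero at some point where neither
    [H] nor the denominator vanishes. *)
Lemma ff_eq_of_val f g H (e : nat) : H \is e.-homog -> nonzero_on C H ->
  (forall y, on_curve C y -> form_at H y != 0 -> exists2 c, is_val y f c & is_val y g c) ->
  f = g.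
Proof.
move=> hH nH E; apply/eqP; rewrite -subr_eq0; apply/eqP.
have [r fg] : exists r, f - g = \pi_K r by exists (repr (f - g)); rewrite reprK.
rewrite fg.
apply/ff_eq0/negP => nr.
have := nonzero_onM (dhomogM hH (rf_den_homog r)) (rf_num_homog r)
  (nonzero_onM hH (rf_den_homog r) nH (rf_den_nz r)) nr.
case/asboolP=> y Cy; rewrite !form_atM !mulf_eq0 !negb_or => /andP[/andP[Hy dy] ny].
have [c fc gc] := E y Cy Hy.
have v0 := is_valB fc gc; rewrite subrr fg in v0.
have : form_at (rf_num r) y / form_at (rf_den r) y = 0.
  by apply: is_val_uniq v0 => //; exists r; rewrite // divfK.
by move/eqP; rewrite mulf_eq0 invr_eq0 (negPf ny) (negPf dy).
Qed.

End Values.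

(** * Affine charts and global functions *)

Section Chart.

Variables (k : closedFieldType) (n : nat) (C : smooth_projective_curve k n).
Variables (j0 : 'I_n.+1) (nz0 : nonzero_on C 'X_j0).
Local Notation K := (function_field C).
Local Notation form := {mpoly k[n.+1]}.
Implicit Types (x y : pspace k n) (f u : K) (F G H : form).

Lemma form_at_var i x : form_at 'X_i x = hcoord x i.
Proof. exact: mevalXU. Qed.

Definition affine_coord i : K :=
  \pi_K (mk_ratfun (dhomog_var k i) (dhomog_var k j0) nz0).

(** Dehomogenization at [j0], with homogeneous coordinates rescaled by [u]: this allows a change of
    pivot and a normalization at a given point. *)
Definition chart u F : K := mmap (@ff_const k n C) (fun i => u * affine_coord i) F.

Lemma chartC u c : chart u c%:MP = ff_const C c.
Proof. exact: mmapC. Qed.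

Lemma chartX u i : chart u 'X_i = u * affine_coord i.
Proof. by rewrite /chart mmapX mmap1U. Qed.

Lemma chartD u F G : chart u (F + G) = chart u F + chart u G.
Proof. exact: mmapD. Qed.

Lemma chartM u F G : chart u (F * G) = chart u F * chart u G.
Proof. exact: rmorphM. Qed.

Lemma chart_scale u d F : F \is d.-homog -> chart u F = u ^+ d * chart 1 F.
Proof.
move=> hF; rewrite /chart -(mmap_homog_scale _ _ _ hF); congr (mmap _ _ F).
by apply/funext => i; rewrite mul1r.
Qed.

Lemma chart_ind u (P : K -> k -> Prop) (v : 'I_n.+1 -> k) :
  (forall c, P (ff_const C c) c) -> (forall i, P (u * affine_coord i) (v i)) ->
  (forall f g c d, P f c -> P g d -> P (f + g) (c + d)) ->
  (forall f g c d, P f c -> P g d -> P (f * g) (c * d)) ->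
  forall F, P (chart u F) F.@[v].
Proof.
move=> PC PX PD PM; elim/mpoly_ring_ind => [c|i|F G PF PG|F G PF PG].
- by rewrite chartC mevalC.
- by rewrite chartX mevalXU.
- by rewrite chartD mevalD; apply: PD.
- by rewrite chartM mevalM; apply: PM.
Qed.

Lemma is_val_affine_coord y i : form_at 'X_j0 y != 0 ->
  is_val y (affine_coord i) ((form_at 'X_j0 y)^-1 * hcoord y i).
Proof.
move=> y0; exists (mk_ratfun (dhomog_var k i) (dhomog_var k j0) nz0) => //.
by rewrite !rf_opE; split; rewrite // form_at_var mulrAC mulVf ?mul1r // -form_at_var.
Qed.

Lemma is_val_chart1 y F d : F \is d.-homog -> form_at 'X_j0 y != 0 ->
  is_val y (chart 1 F) (form_at 'X_j0 y ^- d * form_at F y).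
Proof.
move=> hF y0; rewrite -exprVn -(meval_homog_scale _ _ hF).
apply: chart_ind => [c|i|f g c e|f g c e].
- exact: is_val_const.
- by rewrite mul1r; apply: is_val_affine_coord.
- exact: is_valD.
- exact: is_valM.
Qed.

Lemma chart_vanishing u F d : F \is d.-homog ->
  (forall y, on_curve C y -> form_at F y = 0) -> chart u F = 0.
Proof.
move=> hF F0; rewrite (chart_scale _ hF); suff -> : chart 1 F = 0 by rewrite mulr0.
apply: (ff_eq_of_val (dhomog_var k j0) nz0) => y Cy y0; exists 0.
  by have := is_val_chart1 hF y0; rewrite F0 // mulr0.
by rewrite -(rmorph0 (@ff_const k n C)); apply: is_val_const.
Qed.

Lemma chart_neq0 u F d : u != 0 -> F \is d.-homog -> nonzero_on C F -> chart u F != 0.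
Proof.
move=> u0 hF nF; rewrite (chart_scale _ hF) mulf_neq0 ?expf_neq0 //.
have /asboolP[y Cy] := nonzero_onM (dhomog_var k j0) hF nz0 nF.
rewrite form_atM mulf_eq0 negb_or => /andP[y0 Fy]; apply/eqP => F0.
have := is_val_chart1 hF y0; rewrite F0 => /(is_val_uniq Cy (is_val_const C y 0)).
by move/esym/eqP; rewrite mulf_eq0 invr_eq0 expf_eq0 (negPf y0) andbF (negPf Fy).
Qed.

Lemma chart_frac u (r : ratfun_rep C) : u != 0 ->
  \pi_K r = chart u (rf_num r) / chart u (rf_den r).
Proof.
move=> u0; apply/(canRL (mulfK _)).
  exact: chart_neq0 u0 (rf_den_homog r) (rf_den_nz r).
rewrite (chart_scale _ (rf_den_homog r)) (chart_scale _ (rf_num_homog r)) mulrCA.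
congr (_ * _).
have hH := dhomogM (dhomog_var k j0) (rf_den_homog r).
apply: (ff_eq_of_val hH (nonzero_onM _ _ nz0 (rf_den_nz r))).
- exact: dhomog_var.
- exact: rf_den_homog.
move=> y Cy; rewrite form_atM mulf_eq0 negb_or => /andP[y0 dy].
have v : is_val y (\pi_K r) (form_at (rf_num r) y / form_at (rf_den r) y).
  by exists r; rewrite // divfK.
exists (form_at 'X_j0 y ^- rf_deg r * form_at (rf_num r) y).
  have := is_valM v (is_val_chart1 (rf_den_homog r) y0).
  by congr is_val; rewrite mulrCA divfK.
exact: is_val_chart1 (rf_num_homog r) y0.
Qed.

End Chart.

Section GlobalFunctions.

Variables (k : closedFieldType) (n : nat) (C : smooth_projective_curve k n).
Local Notation K := (function_field C).

Lemma hcoord_neq0 (x : pspace k n) : exists i, hcoord x i != 0.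
Proof.
apply: contrapT => nx; have : vpick (val x) == 0.
  apply/eqP/rowP => i; rewrite mxE; apply/eqP; apply: contrapT => xi.
  by apply: nx; exists i; apply/negP.
by rewrite vpick0 -dimv_eq0 (eqP (valP x)).
Qed.

Lemma nonzero_on_var x i : on_curve C x -> hcoord x i != 0 -> nonzero_on C 'X_i.
Proof. by move=> Cx xi; apply/asboolP; exists x; rewrite // form_at_var. Qed.

(** The coordinates [hcoord] come from a chosen vector on the line, so prescribed ones are recovered
    only up to a scalar. *)
Lemma point_of_coords (b : 'I_n.+1 -> k) i : b i != 0 ->
  exists (x : pspace k n) (s : k), s != 0 /\ forall l, hcoord x l = s * b l.
Proof.
move=> bi; pose v : 'rV[k]_n.+1 := \row_l b l.
have v0 : v != 0 by apply: contraNneq bi => /rowP/(_ i); rewrite !mxE => ->.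
have dv : \dim <[v]>%VS == 1%N by rewrite dim_vline v0.
exists (Sub <[v]>%VS dv); rewrite /hcoord SubK.
have : vpick <[v]> != 0 by rewrite vpick0 -dimv_eq0 (eqP dv).
have /vlineP[s ->] := memv_pick <[v]>; rewrite scaler_eq0 negb_or => /andP[s0 _].
by exists s; split=> // l; rewrite !mxE.
Qed.

(** This finds a coordinate of least valuation: running through the list, the pivot moves to [l]
    whenever [a l / a j] has no value. *)
Lemma place_graph_best (F : fieldType) (i : {rmorphism k -> F}) V (I : finType)
    (a : I -> F) (i0 : I) : place_graph i V ->
  (forall f, (exists b, V (f, b)) \/ (exists b, V (f^-1, b))) -> a i0 != 0 ->
  exists2 j, a j != 0 & forall l, exists b, V (a l / a j, b).
Proof.
move=> VP Vtot a0; suff [j aj Vj] : exists2 j, a j != 0 &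
    forall l, l \in enum I -> exists b, V (a l / a j, b).
  by exists j => // l; apply: Vj; rewrite mem_enum.
elim: (enum I) => [|l s [j aj IH]]; first by exists i0.
have [[b Vl]|[b]] := Vtot (a l / a j).
  by exists j => // m; rewrite inE => /orP[/eqP->|/IH //]; exists b.
rewrite invf_div => Vl; have [al|al] := eqVneq (a l) 0.
  exists j => // m; rewrite inE => /orP[/eqP->|/IH //].
  by exists 0; rewrite al mul0r; exact: place_graph0 VP.
exists l => // m; rewrite inE => /orP[/eqP->|/IH[c Vm]].
  by exists 1; rewrite divff //; exact: place_graph1 VP.
exists (c * b); have := place_graphM VP Vm Vl.
by rewrite -[X in V X]/(_ * _, _ * _) mulrA divfK.
Qed.

Lemma regular_everywhere_const (f : K) :
  (forall y, on_curve C y -> regular_at y f) -> exists c, f = ff_const C c.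
Proof.
move=> freg; apply: contrapT => fconst.
have f0 : f != 0 by apply/eqP => f0; apply: fconst; exists 0; rewrite f0 rmorph0.
have gk c : f^-1 <> @ff_const k n C c.
  by move=> gc; apply: fconst; exists c^-1; rewrite fmorphV /= -gc invrK.
have [V [VP Vmax Vg]] := place_exists gk.
have [[x0 Cx0] _] := curve_irreducible C.
have [j0 xj0] := hcoord_neq0 x0.
have nz0 := nonzero_on_var Cx0 xj0.
pose a := affine_coord nz0.
have aj0 : a j0 != 0.
  by have := chart_neq0 nz0 (oner_neq0 _) (dhomog_var k j0) nz0; rewrite chartX mul1r.
(* The valuative criterion of properness: after division by the best coordinate, all coordinates
   have values in k, and these define the centre of the place. *)
have [j aj Va] := place_graph_best VP (place_graph_total VP Vmax) aj0.
have [b Vb] := choice Va.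
have ch F : V (chart nz0 (a j)^-1 F, F.@[b]).
  apply: (chart_ind (P := fun u c => V (u, c))).
  - by have [] := VP.
  - by move=> i; rewrite mulrC; apply: Vb.
  - by move=> u v c d Vu Vv; apply: (place_graphD VP Vu Vv).
  - by move=> u v c d Vu Vv; apply: (place_graphM VP Vu Vv).
have Vinj c : V (0, c) -> c = 0 by have [_ _ _] := VP; apply.
have bj : b j != 0.
  apply/eqP => bj; have := Vb j; rewrite bj divff // => V10.
  have := place_graphB VP (place_graph1 VP) V10.
  rewrite -[X in V X]/(1 - 1, 1 - 0) subrr subr0 => /Vinj/eqP.
  by rewrite oner_eq0.
have [P [s [s0 Ps]]] := point_of_coords bj.
have form_atP F d : F \is d.-homog -> form_at F P = s ^+ d * F.@[b].
  by move=> hF; rewrite -(meval_homog_scale _ _ hF); apply: meval_eq.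
(* The equations of the curve are 0 in the function field, so their values under the place vanish
   too. *)
have CP : on_curve C P.
  have [T [Thom CT]] := curve_closed C.
  rewrite CT => F TF; have [d hF] := Thom F TF.
  have := ch F; rewrite (chart_vanishing _ _ hF) => [/Vinj Fb|y].
    by rewrite (form_atP F d hF) Fb mulr0.
  by rewrite CT; apply.
(* Regularity at the centre gives [f] a value under the place; since its inverse has value 0, so
   would 1. *)
have [r fr] := freg P CP.
rewrite (form_atP _ _ (rf_den_homog r)) mulf_eq0 negb_or => /andP[_ denb].
have Vden := place_graphV VP Vmax (ch (rf_den r)) denb.
have Vf := place_graphM VP (ch (rf_num r)) Vden.
have Vfg := place_graphM VP Vf Vg.
have aj' : (a j)^-1 != 0 by rewrite invr_eq0.
move: Vfg; rewrite -[X in V X]/(_ / _ * _, _ * 0) -(chart_frac nz0 r aj') -fr.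
rewrite mulfV // mulr0 => V10.
have := place_graphB VP (place_graph1 VP) V10.
rewrite -[X in V X]/(1 - 1, 1 - 0) subrr subr0 => /Vinj/eqP.
by rewrite oner_eq0.
Qed.

End GlobalFunctions.

(** * Local rings *)

(** A matrix of maximal rank among those with row space in [W] works, since adjoining a further
    vector of [W] cannot raise the rank. *)
Lemma subspace_rowspace (F : fieldType) (N : nat) (W : 'rV[F]_N -> Prop) :
  W 0 -> (forall a u v, W u -> W v -> W (a *: u + v)) ->
  exists M : 'M[F]_N, forall u : 'rV_N, (u <= M)%MS <-> W u.
Proof.
move=> W0 WD.
pose Q r := `[< exists M : 'M[F]_N, \rank M = r /\ forall u : 'rV_N, (u <= M)%MS -> W u >].
have exQ : exists r, Q r.
  exists 0%N; apply/asboolP; exists 0; split; first exact: mxrank0.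
  by move=> u; rewrite submx0 => /eqP->.
have ubQ r : Q r -> (r <= N)%N by move=> /asboolP[M [<- _]]; apply: rank_leq_row.
case: (ex_maxnP exQ ubQ) => r /asboolP[M [Mr MW]] rmax; exists M => u; split; first exact: MW.
move=> Wu; have /rmax : Q (\rank (M + u)%MS).
  apply/asboolP; exists (M + u)%MS; split=> // v /sub_addsmxP[[p q] ->] /=.
  rewrite addrC [q]mx11_scalar mul_scalar_mx; apply: (WD) => //.
  by apply: MW; apply: submxMl.
rewrite -Mr; have := mxrank_leqif_sup (addsmxSl M u) => /leqifP.
case: ifP => [sub _ _|_]; last by rewrite ltnNge => /negPf->.
by apply: submx_trans sub; apply: addsmxSr.
Qed.

(** Nakayama's lemma by elimination: in the relation for the head [b], the coefficient [1 - a] is a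
    unit, so [b] can be solved for and substituted into the relations for the remaining
    generators. *)
Lemma nakayama_principal (F : fieldType) (O M : F -> Prop) (s : seq F) (t : F) :
  subring_pred O -> M 0 -> (forall u v, M u -> M v -> M (u - v)) ->
  (forall u v, O u -> M v -> M (u * v)) -> (forall u, M u -> O u) ->
  (forall u, M u -> 1 - u != 0 /\ O (1 - u)^-1) ->
  (forall y, y \in s -> exists2 c, O c & in_span M s (y - c * t)) ->
  forall y, y \in s -> exists2 c, O c & y = c * t.
Proof.
move=> [O1 OB OM] M0 MB MM MO unit1B.
have OD u v : O u -> O v -> O (u + v).
  move=> Ou Ov; rewrite -[v]opprK -[- v]sub0r.
  by apply: (OB) => //; apply: (OB) => //; apply: (MO).
elim: s => [|b s IH] rel y //.
have [c Oc [a Ma relb]] := rel b (mem_head _ _).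
have [a1 Oa1] := unit1B a Ma.
pose w := (1 - a)^-1.
have bE : in_span M s (b - w * c * t).
  have -> : b - w * c * t = w * (b - c * t - a * b).
    by rewrite /w; field.
  by apply: in_spanM relb => d; apply: (MM).
have spanD := in_spanD M0 MB.
have {}IH : forall y, y \in s -> exists2 c, O c & y = c * t.
  apply: IH => z zs; have [d Od [e Me relz]] : exists2 d, O d & in_span M (b :: s) (z - d * t).
    by apply: rel; rewrite inE zs orbT.
  exists (d + e * (w * c)); first by apply: (OD) => //; apply: (OM); [exact: MO|exact: OM].
  have -> : z - (d + e * (w * c)) * t = (z - d * t - e * b) + e * (b - w * c * t) by ring.
  apply: (spanD) => //; apply: in_spanM bE => m; apply: (MM); exact: MO.
rewrite inE => /orP[/eqP->|]; last exact: IH.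
suff [d Od bd] : exists2 d, O d & b - w * c * t = d * t.
  exists (w * c + d); last by rewrite mulrDl -bd addrC subrK.
  by apply: (OD) => //; apply: (OM).
apply: (in_span_sub (Q := fun e => exists2 d, O d & e = d * t)) bE.
- by exists 0; [exact: MO|rewrite mul0r].
- move=> _ _ [d Od ->] [e Oe ->]; exists (d - e); first exact: OB.
  by rewrite mulrBl.
- move=> e z Me /IH[d Od ->]; exists (e * d); last by rewrite mulrA.
  by apply: (OM) => //; apply: (MO).
Qed.

Section LocalRing.

Variables (k : closedFieldType) (n : nat) (C : smooth_projective_curve k n).
Variables (x : pspace k n) (Cx : on_curve C x).
Local Notation K := (function_field C).
Local Notation form := {mpoly k[n.+1]}.
Local Notation const := (@ff_const k n C).
Local Notation O := (@regular_at k n C x).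
Local Notation M := (@vanishes_at k n C x).
Implicit Types (f g u : K) (F G H : form).

Lemma regular_const c : O (const c).
Proof. by apply/regular_atP; exists c; apply: is_val_const. Qed.

Lemma regular_subring : subring_pred O.
Proof.
split; first by rewrite -(rmorph1 const); apply: regular_const.
- move=> f g /regular_atP[c fc] /regular_atP[d gd].
  by apply/regular_atP; exists (c - d); apply: is_valB.
- move=> f g /regular_atP[c fc] /regular_atP[d gd].
  by apply/regular_atP; exists (c * d); apply: is_valM.
Qed.

Lemma regularM f g : O f -> O g -> O (f * g).
Proof. by have [_ _] := regular_subring; apply. Qed.

Lemma vanishes_regular f : M f -> O f.
Proof. by move/vanishes_atP => f0; apply/regular_atP; exists 0. Qed.

Lemma vanishes0 : M 0.
Proof. by apply/vanishes_atP; rewrite -(rmorph0 const); apply: is_val_const. Qed.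

Lemma vanishesB f g : M f -> M g -> M (f - g).
Proof.
move=> /vanishes_atP f0 /vanishes_atP g0; apply/vanishes_atP.
by rewrite -(subrr 0); apply: is_valB.
Qed.

Lemma vanishesM f g : O f -> M g -> M (f * g).
Proof.
move=> /regular_atP[c fc] /vanishes_atP g0; apply/vanishes_atP.
by rewrite -(mulr0 c); apply: is_valM.
Qed.

Lemma is_val_not_vanishes f c : is_val x f c -> (~ M f) <-> c != 0.
Proof.
move=> fc; split=> [nM|c0 /vanishes_atP f0].
  by apply/eqP => c0; apply/nM/vanishes_atP; rewrite -c0.
by rewrite (is_val_uniq Cx fc f0) eqxx in c0.
Qed.

Lemma not_vanishes1 : ~ M 1.
Proof.
apply/(is_val_not_vanishes (c := 1)); last exact: oner_neq0.
by rewrite -(rmorph1 const); apply: is_val_const.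
Qed.

Lemma regularV f : O f -> ~ M f -> O f^-1 /\ ~ M f^-1.
Proof.
move=> /regular_atP[c fc] /(is_val_not_vanishes fc) c0.
have fv := is_valV Cx c0 fc; split; first by apply/regular_atP; exists c^-1.
by apply/(is_val_not_vanishes fv); rewrite invr_eq0.
Qed.

Lemma not_vanishesM f g : O f -> ~ M f -> O g -> ~ M g -> ~ M (f * g).
Proof.
move=> /regular_atP[c fc] /(is_val_not_vanishes fc) c0.
move=> /regular_atP[d gd] /(is_val_not_vanishes gd) d0.
by apply/(is_val_not_vanishes (is_valM fc gd)); rewrite mulf_neq0.
Qed.

Lemma vanishes_unit1B f : M f -> 1 - f != 0 /\ O (1 - f)^-1.
Proof.
move=> Mf; have [O1 OB _] := regular_subring.
have nM : ~ M (1 - f).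
  move=> M1f; apply: not_vanishes1; have := vanishesB Mf (vanishesB vanishes0 M1f).
  by rewrite sub0r opprK addrC subrK.
split; last by apply: (regularV _ nM).1; apply: (OB) => //; apply: vanishes_regular.
by apply/eqP => f1; apply: nM; rewrite f1; apply: vanishes0.
Qed.

Variables (j : 'I_n.+1) (xj : hcoord x j != 0).
Let nzj := nonzero_on_var Cx xj.

(* The affine coordinates of the chart at j are normalized so as to take the
   value hcoord x at x. *)
Definition local_chart F : K := chart nzj (const (hcoord x j)) F.

Definition local_coord i : K := local_chart 'X_i - const (hcoord x i).

Definition local_coords : seq K := codom local_coord.

Lemma const_xj_neq0 : const (hcoord x j) != 0.
Proof. by rewrite fmorph_eq0. Qed.

Lemma is_val_local_chart F : is_val x (local_chart F) (form_at F x).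
Proof.
apply: chart_ind => [c|i|f g c e|f g c e].
- exact: is_val_const.
- have xj' : form_at 'X_j x != 0 by rewrite form_at_var.
  have := is_valM (is_val_const C x (hcoord x j)) (is_val_affine_coord nzj i xj').
  by rewrite form_at_var mulVKf.
- exact: is_valD.
- exact: is_valM.
Qed.

Lemma regular_local_chart F : O (local_chart F).
Proof. by apply/regular_atP; exists (form_at F x); apply: is_val_local_chart. Qed.

Lemma vanishes_local_coord i : M (local_coord i).
Proof.
apply/vanishes_atP; rewrite -(subrr (hcoord x i)); apply: is_valB.
  by rewrite -form_at_var; apply: is_val_local_chart.
exact: is_val_const.
Qed.

Lemma local_coord_pivot : local_coord j = 0.
Proof.
rewrite /local_coord /local_chart chartX.
suff -> : affine_coord nzj j = 1 by rewrite mulr1 subrr.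
rewrite -(rmorph1 const); apply/ratfunP => y Cy.
by rewrite !rf_opE !form_atE; ring.
Qed.

Lemma mem_local_coords i : local_coord i \in local_coords.
Proof. exact: codom_f. Qed.

(** Taylor expansion to order zero, by induction on [F]. *)
Lemma local_coords_span1 F :
  in_span O local_coords (local_chart F - const (form_at F x)).
Proof.
have [O1 OB OM] := regular_subring.
have O0 : O 0 by rewrite -(subrr 1); apply: (OB).
elim/mpoly_ring_ind: F => [c|i|F G IF IG|F G IF IG].
- by rewrite /local_chart chartC form_atC subrr; apply: in_span0.
- by rewrite form_at_var; apply: in_span_mem => //; apply: mem_local_coords.
- rewrite /local_chart chartD form_atD rmorphD opprD addrACA.
  exact: in_spanD.
- rewrite /local_chart chartM form_atM rmorphM -!/(local_chart _).
  have -> : local_chart F * local_chart G - const (form_at F x) * const (form_at G x) =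
      local_chart F * (local_chart G - const (form_at G x)) +
      const (form_at G x) * (local_chart F - const (form_at F x)) by ring.
  apply: in_spanD => //.
    by apply: in_spanM IG => c; apply: (OM); apply: regular_local_chart.
  by apply: in_spanM IF => c; apply: (OM); apply: regular_const.
Qed.

Lemma vanishes_span f : M f -> in_span O local_coords f.
Proof.
move=> [r -> [den num]]; rewrite (chart_frac nzj r const_xj_neq0) mulrC.
have := local_coords_span1 (rf_num r); rewrite num rmorph0 subr0.
apply: in_spanM => c; apply: regularM; apply: (regularV _ _).1.
  exact: regular_local_chart.
exact/(is_val_not_vanishes (is_val_local_chart _)).
Qed.

Definition differential F : K :=
  \sum_i const (form_at F^`M(i) x) * local_coord i.

Lemma vanishes_differential F : M (differential F).
Proof.
apply: (big_ind M); first exact: vanishes0.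
- move=> f g Mf Mg; rewrite -[g]opprK -[- g]sub0r.
  by apply: vanishesB => //; apply: vanishesB => //; apply: vanishes0.
- move=> i _; apply: vanishesM; [exact: regular_const|exact: vanishes_local_coord].
Qed.

(* Combinations of generators of the maximal ideal with coefficients in that
   ideal form its square. *)
Lemma local_coords_span2 F :
  in_span M local_coords (local_chart F - const (form_at F x) - differential F).
Proof.
have spanD := in_spanD vanishes0 vanishesB.
have [O1 OB OM] := regular_subring.
have O0 : O 0 by rewrite -(subrr 1); apply: (OB).
elim/mpoly_ring_ind: F => [c|i|F G IF IG|F G IF IG].
- rewrite /local_chart chartC form_atC subrr /differential big1 ?subr0.
    exact/in_span0/vanishes0.
  by move=> i _; rewrite mderivC form_at0 rmorph0 mul0r.
- suff -> : differential 'X_i = local_coord i.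
    by rewrite form_at_var subrr; apply/in_span0/vanishes0.
  rewrite /differential (bigD1 i) //= big1 ?addr0 => [|l li].
    have -> : 'X_i^`M(i) = 1 :> form.
      rewrite mderivX mnm1E eqxx scale1r -[RHS]mpolyX0; congr mpolyX.
      by apply/mnmP => l; rewrite mnmBE subnn mnm0E.
    by rewrite form_at1 rmorph1 mul1r.
  by rewrite mderivX mnm1E eq_sym (negPf li) scale0r form_at0 rmorph0 mul0r.
- have -> : differential (F + G) = differential F + differential G.
    rewrite /differential -big_split; apply: eq_bigr => i _ /=.
    by rewrite mderivD form_atD rmorphD mulrDl.
  rewrite /local_chart chartD form_atD rmorphD -!/(local_chart _).
  by have := spanD _ _ _ IF IG; congr in_span; ring.
- have -> : differential (F * G) = const (form_at G x) * differential F +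
      const (form_at F x) * differential G.
    rewrite /differential !mulr_sumr -big_split; apply: eq_bigr => i _ /=.
    by rewrite mderivM form_atD !form_atM rmorphD !rmorphM; ring.
  rewrite /local_chart chartM form_atM rmorphM -!/(local_chart _).
  set f := local_chart F in IF *; set g := local_chart G in IG *.
  set f0 := const (form_at F x) in IF *; set g0 := const (form_at G x) in IG *.
  set df := differential F in IF *; set dg := differential G in IG *.
  (* The Leibniz rule up to remainders: the first two terms carry those of the factors, and
     [df * dg] is a product of two vanishing functions. *)
  have -> : f * g - f0 * g0 - (g0 * df + f0 * dg) =
     f * (g - g0 - dg) + (g0 + dg) * (f - f0 - df) + df * dg by ring.
  have Of : O f by apply: regular_local_chart.
  have Odg : O (g0 + dg).
    rewrite -[dg]opprK -[- dg]sub0r; apply: (OB); first exact: regular_const.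
    by apply: (OB) => //; apply/vanishes_regular/vanishes_differential.
  apply: (spanD); first apply: (spanD).
  + by apply: in_spanM IG => c; apply: vanishesM.
  + by apply: in_spanM IF => c; apply: vanishesM.
  + apply: in_spanM (vanishes_span (vanishes_differential G)) => c Oc.
    by rewrite mulrC; apply: vanishesM => //; apply: vanishes_differential.
Qed.

End LocalRing.

(** * Uniformizers and orders *)

(** Euler's relation puts the vector of a point in the tangent space of the cone there. *)
Lemma mpoly_euler n (R : comNzRingType) d (F : {mpoly R[n]}) : F \is d.-homog ->
  \sum_i F^`M(i) * 'X_i = d%:R *: F.
Proof.
move=> /dhomogP hF.
transitivity (\sum_(m <- msupp F) F@_m *: (\sum_i 'X_[m]^`M(i) * 'X_i)).
  rewrite (eq_bigr _ (fun m _ => scaler_sumr _ _ _ _)) exchange_big.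
  apply: eq_bigr => i _; rewrite {1}(mpolyE F) raddf_sum mulr_suml.
  by apply: eq_bigr => m _; rewrite /= mderivZ scalerAl.
rewrite {3}(mpolyE F) scaler_sumr !big_seq; apply: eq_bigr => m mF.
rewrite scalerA mulrC -scalerA; congr (_ *: _).
transitivity (\sum_i (m i)%:R *: ('X_[m] : {mpoly R[n]})).
  apply: eq_bigr => i _; rewrite mderivX -scalerAl.
  have [->|mi] := eqVneq (m i) 0%N; first by rewrite !scale0r.
  rewrite -mpolyXD submK //; apply/mnm_lepP => l; rewrite mnm1E.
  by case: eqP => // <-; rewrite lt0n.
by rewrite -scaler_suml -natr_sum -mdegE (hF m mF).
Qed.

Section Uniformizer.

Variables (k : closedFieldType) (n : nat) (C : smooth_projective_curve k n).
Local Notation K := (function_field C).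
Local Notation form := {mpoly k[n.+1]}.
Local Notation const := (@ff_const k n C).

Lemma pspace_line (x : pspace k n) : val x = <[vpick (val x)]>%VS.
Proof.
apply/esym/eqP; rewrite eqEdim (eqP (valP x)) -memvE memv_pick dim_vline.
by rewrite vpick0 -dimv_eq0 (eqP (valP x)).
Qed.

Lemma pspace_eq (x y : pspace k n) (s : k) :
  (forall i, hcoord y i = s * hcoord x i) -> y = x.
Proof.
move=> yx; have E : vpick (val y) = s *: vpick (val x).
  by apply/rowP => i; rewrite mxE; apply: yx.
apply: val_inj; rewrite pspace_line [RHS]pspace_line E.
have s0 : s != 0.
  apply/eqP => s0; move/eqP: E; rewrite s0 scale0r vpick0 -dimv_eq0.
  by rewrite (eqP (valP y)).
apply/eqP; rewrite eqEsubv -!memvE memvZ ?memv_line //=.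
by apply/vlineP; exists s^-1; rewrite scalerA mulVf // scale1r.
Qed.

Lemma curve_two_points : exists p q, [/\ on_curve C p, on_curve C q & p <> q].
Proof.
have [[Y [YP Ylt]] _] := curve_dim1 C.
have [_ [[q Yq] _] YC0] := YP 0%N isT; have [_ _ YC1] := YP 1%N isT.
have [sub nsub] := Ylt 0%N isT.
have /existsNP[p /not_implyP[Yp nYp]] := nsub.
by exists p, q; split; [exact: YC1|exact: YC0|move=> pq; apply: nYp; rewrite pq].
Qed.

Variables (x : pspace k n) (Cx : on_curve C x).
Local Notation O := (@regular_at k n C x).
Local Notation M := (@vanishes_at k n C x).

(** * The cotangent space at a smooth point *)

Section Pivot.

Variables (j : 'I_n.+1) (xj : hcoord x j != 0).
Local Notation ys := (local_coords Cx xj).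
Local Notation y := (local_coord Cx xj).

(** Otherwise all ratios of coordinates are constant and the curve is a single point. *)
Lemma local_coord_neq0 : exists i, y i != 0.
Proof.
apply: contrapT => /forallNP y0.
have Cpt z : on_curve C z -> z = x.
  move=> Cz; apply: (@pspace_eq _ _ (hcoord z j / hcoord x j)) => i.
  have /eqP : y i = 0 by apply/eqP; apply: contrapT => /negP; apply: y0.
  rewrite /local_coord subr_eq0 /local_chart chartX => /eqP.
  rewrite -[LHS]/(ff_mul _ _) ff_mulE => /ratfunP/(_ z Cz).
  rewrite !rf_opE !form_atE !form_at_var !mulr1 mul1r => E.
  by apply: (mulfI xj); rewrite E; field.
have [p [q [Cp Cq]]] := curve_two_points.
by rewrite (Cpt p Cp) (Cpt q Cq).
Qed.

(** The plane [T] contains the vector of [x], whose coordinate at [j] is nonzero, so it meets the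
    hyperplane where this coordinate vanishes in a line. *)
Lemma tangent_line_proportional (T : {vspace 'rV[k]_n.+1}) (w w' : 'rV_n.+1) :
  \dim T = 2%N -> (forall v, v \in T <-> in_tangent (on_curve C) x v) ->
  w \in T -> w 0 j = 0 -> w != 0 -> w' \in T -> w' 0 j = 0 -> exists b, w' = b *: w.
Proof.
move=> dimT TP wT wj w0 w'T w'j; pose v := vpick (val x).
have vj : v 0 j != 0 by [].
have v0 : v != 0 by apply: contraNneq vj => ->; rewrite mxE.
have vT : v \in T.
  apply/TP => F [[d hF] Fx].
  transitivity (form_at (\sum_i F^`M(i) * 'X_i) x).
    rewrite /form_at raddf_sum; apply: eq_bigr => i _ /=.
    by rewrite mevalM mevalXU.
  by rewrite (mpoly_euler hF) /form_at mevalZ [X in _ * X]Fx // mulr0.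
have cap0 : (<[v]> :&: <[w]> = 0)%VS.
  apply/eqP; rewrite -subv0; apply/subvP => u; rewrite memv_cap memv0.
  move=> /andP[/vlineP[a ->] /vlineP[b E]].
  have := congr1 (fun u : 'rV_n.+1 => u 0 j) E; rewrite !mxE wj mulr0.
  by move/eqP; rewrite mulf_eq0 (negPf vj) orbF => /eqP->; rewrite scale0r.
have TE : (<[v]> + <[w]> = T)%VS.
  apply/eqP; rewrite eqEdim subv_add -!memvE vT wT dimv_disjoint_sum //.
  by rewrite !dim_vline v0 w0 dimT.
move: w'T; rewrite -TE => /memv_addP[_ /vlineP[a ->] [_ /vlineP[b ->] E]].
exists b; rewrite E; have := congr1 (fun u : 'rV_n.+1 => u 0 j) E.
rewrite w'j !mxE wj mulr0 addr0 => /esym/eqP.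
by rewrite mulf_eq0 (negPf vj) orbF => /eqP->; rewrite scale0r add0r.
Qed.

(** The quotient of the maximal ideal by its square has dimension at most one. The linear relations
    among the local coordinates modulo the square form the left kernel of a matrix [B]. They include
    all gradients of vanishing forms, so the columns of [B] are tangent vectors; these have
    coordinate 0 at [j] and are therefore proportional. *)
Lemma cotangent_line : exists l, forall i, exists c,
  in_span M ys (y i - const c * y l).
Proof.
have [T [dimT TP]] := curve_smooth Cx.
pose L (u : 'rV[k]_n.+1) := \sum_i const (u 0 i) * y i.
have LD a u v : L (a *: u + v) = const a * L u + L v.
  rewrite /L mulr_sumr -big_split; apply: eq_bigr => i _ /=.
  by rewrite !mxE rmorphD rmorphM; ring.
have Ldelta l : L (delta_mx 0 l) = y l.
  rewrite /L (bigD1 l) //= big1 ?addr0 => [|i il].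
    by rewrite mxE !eqxx rmorph1 mul1r.
  by rewrite mxE (negPf il) andbF rmorph0 mul0r.
have M0 := vanishes0 C x; have MB := @vanishesB _ _ C x.
have Mconst a f : in_span M ys f -> in_span M ys (const a * f).
  by apply: in_spanM => c; apply: vanishesM; apply: regular_const.
have [|a u v Wu Wv|A AP] := @subspace_rowspace k n.+1 (fun u => in_span M ys (L u)).
- rewrite [L 0]big1; first exact: in_span0.
  by move=> i _; rewrite mxE rmorph0 mul0r.
- by rewrite LD; apply: in_spanD => //; apply: Mconst.
have [B BP] : exists B : 'M_n.+1, forall u : 'rV_n.+1, (u <= A)%MS = (u *m B == 0).
  by exists (cokermx A) => u; rewrite submxE.
have dA F : pvanishing (on_curve C) F ->
    ((\row_i form_at F^`M(i) x) *m B = 0).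
  move=> [[d hF] Fx]; apply/eqP; rewrite -BP; apply/AP.
  (* The chart function and the value of [F] are both 0, so only the differential remains in the
     square. *)
  have := local_coords_span2 Cx xj F.
  rewrite /local_chart (chart_vanishing _ _ hF) // Fx // rmorph0 subr0 sub0r.
  have -> : differential Cx xj F = L (\row_i form_at F^`M(i) x).
    by apply: eq_bigr => i _; rewrite mxE.
  have MN c : M c -> M (- c) by move=> Mc; rewrite -sub0r; apply: MB.
  by move/(in_spanN MN); rewrite opprK.
have jA c : B j c = 0.
  have : (delta_mx 0 j : 'rV_n.+1) *m B = 0.
    apply/eqP; rewrite -BP; apply/AP; rewrite Ldelta local_coord_pivot.
    exact: in_span0.
  by rewrite -rowE => /rowP/(_ c); rewrite !mxE.
pose w c : 'rV[k]_n.+1 := (col c (B))^T.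
have wE c i : w c 0 i = B i c by rewrite !mxE.
have wT c : w c \in T.
  apply/TP => F /dA /rowP/(_ c); rewrite !mxE => E; rewrite -[RHS]E.
  by apply: eq_bigr => i _; rewrite !mxE.
have [A0|/matrix0Pn[l [c0 Al]]] := eqVneq (B) 0.
  exists j => i; exists 0; rewrite rmorph0 mul0r subr0 -Ldelta; apply/AP.
  by rewrite BP A0 mulmx0.
have w0 : w c0 != 0 by apply: contraNneq Al => w0; rewrite -wE w0 mxE.
exists l => i; exists (B i c0 / B l c0).
(* Proportional columns of [B] all annihilate this combination of two basis vectors. *)
have W : in_span M ys (L (- B i c0 *: delta_mx 0 l + B l c0 *: delta_mx 0 i)).
  apply/AP; rewrite BP; apply/eqP/rowP => c.
  rewrite mulmxDl -!scalemxAl -!rowE !mxE.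
  have [b wb] := tangent_line_proportional dimT TP (wT c0) (etrans (wE _ _) (jA _)) w0
    (wT c) (etrans (wE _ _) (jA _)).
  have E m : B m c = b * B m c0 by rewrite -!wE wb mxE.
  by rewrite !E; ring.
rewrite -[X in - _ *: _ + X]addr0 LD LD in W.
have L0 : L 0 = 0 by apply: big1 => m _; rewrite mxE rmorph0 mul0r.
have := Mconst (B l c0)^-1 _ W.
rewrite L0 !Ldelta addr0; congr in_span.
have cl : const (B l c0) != 0 by rewrite fmorph_eq0.
have E (F : fieldType) (a b u v : F) : a != 0 ->
    v - b / a * u = a^-1 * (- b * u + a * v) by move=> a0; field.
have -> : const (B i c0 / B l c0) = const (B i c0) / const (B l c0) by exact: fmorph_div.
have -> : const (B l c0)^-1 = (const (B l c0))^-1 by exact: fmorphV.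
have -> : const (- B i c0) = - const (B i c0) by exact: rmorphN.
by move: (const (B l c0)) (const (B i c0)) cl => a b a0; exact/esym/E.
Qed.

End Pivot.

(** Nakayama's lemma lifts a generator modulo the square to a generator of the maximal ideal. *)
Lemma uniformizer_exists : exists t : K, uniformizer_at x t.
Proof.
have [j xj] := hcoord_neq0 x; have [l yl] := cotangent_line xj.
pose y := local_coord Cx xj; have [O1 OB OM] := regular_subring C x.
have gen z : z \in local_coords Cx xj -> exists2 c, O c & z = c * y l.
  move: z; apply: (@nakayama_principal K O M).
  - exact: regular_subring.
  - exact: vanishes0.
  - exact: vanishesB.
  - exact: vanishesM.
  - exact: vanishes_regular.
  - exact: vanishes_unit1B.
  - move=> _ /codomP[i ->]; have [c yc] := yl i.
    by exists (const c) => //; apply: regular_const.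
exists (y l); split.
- have [i] := local_coord_neq0 xj; apply: contraNneq => l0.
  by have [c _ ->] := gen _ (mem_local_coords Cx xj i); rewrite l0 mulr0.
- exact: vanishes_local_coord.
move=> f /(vanishes_span Cx xj).
apply: (in_span_sub (Q := fun e => exists2 d, O d & e = d * y l)).
- by exists 0; [exact/vanishes_regular/vanishes0|rewrite mul0r].
- move=> _ _ [d Od ->] [e Oe ->]; exists (d - e); first exact: OB.
  by rewrite mulrBl.
- by move=> e z Oe /gen[d Od ->]; exists (e * d); [exact: OM|rewrite mulrA].
Qed.

(** * Finite order along a uniformizer *)

Variable t : K.
Hypothesis tP : uniformizer_at x t.

(** Otherwise division by [t] never ends and gives functions [b i] with [b i = b i.+1 * t].
    Multiplied by units they lie in the noetherian coordinate ring of a chart, where one of them is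
    a combination of earlier ones; cancelling [b m] makes a unit a multiple of [t]. *)
Lemma regular_order f : O f -> f != 0 ->
  exists u (m : nat), [/\ O u, ~ M u & f = u * t ^+ m].
Proof.
move=> Of f0; apply: contrapT => fbad.
have [t0 Mt tgen] := tP.
pose bad g := [/\ O g, g != 0 &
  ~ exists u (m : nat), [/\ O u, ~ M u & g = u * t ^+ m]].
have next g : exists h, bad g -> bad h /\ g = h * t.
  have [[Og g0 gbad]|] := pselect (bad g); last by exists 0.
  have Mg : M g.
    by apply: contrapT => nMg; apply: gbad; exists g, 0%N; rewrite expr0 mulr1.
  have [h Oh gh] := tgen g Mg; exists h => _; split=> //; split=> //.
    by apply: contraNneq g0 => h0; rewrite gh h0 mul0r.
  move=> [u [m [Ou Mu hu]]]; apply: gbad; exists u, m.+1; split=> //.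
  by rewrite gh hu exprSr mulrA.
have [nx nxP] := choice next.
pose b i := iter i nx f.
have bbad i : bad (b i).
  by elim: i => [|i IH]; [split|have [] := nxP _ IH].
have bS i : b i = b i.+1 * t by have [] := nxP _ (bbad i).
have bt i m : b i = b (i + m)%N * t ^+ m.
  elim: m => [|m IH]; first by rewrite addn0 mulr1.
  by rewrite IH bS addnS exprS mulrA.
have [j xj] := hcoord_neq0 x.
pose ch := local_chart Cx xj; pose nzj := nonzero_on_var Cx xj.
have [A [e [noethA econst ecoord esub]]] :=
  noetherian_adjoin const (codom (fun i => const (hcoord x j) * affine_coord nzj i)).
have ech F : exists a, e a = ch F.
  elim/mpoly_ring_ind: F => [c|i|F G [a1 e1] [a2 e2]|F G [a1 e1] [a2 e2]].
  - by have [a ea] := econst c; exists a; rewrite ea /ch /local_chart chartC.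
  - have [|a ea] := ecoord (ch 'X_i); last by exists a.
    by rewrite /ch /local_chart chartX; apply: codom_f.
  - by exists (a1 + a2); rewrite rmorphD e1 e2 /ch /local_chart chartD.
  - by exists (a1 * a2); rewrite rmorphM e1 e2 /ch /local_chart chartM.
have eO a : O (e a).
  apply: esub; [exact: regular_subring|exact: regular_const|].
  move=> _ /codomP[i ->].
  by have := regular_local_chart Cx xj 'X_i; rewrite /local_chart chartX.
(* Multiplication by the denominator, a unit at [x], moves [b i] into the coordinate ring. *)
have lift i : exists a, exists2 v, O v /\ ~ M v & e a = b i * v.
  have [[r br den] _ _] := bbad i; have [a ea] := ech (rf_num r).
  exists a, (ch (rf_den r)).
    split; first exact: regular_local_chart.
    exact/(is_val_not_vanishes Cx (is_val_local_chart Cx xj _)).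
  rewrite ea br (chart_frac nzj r (const_xj_neq0 C xj)) divfK //.
  exact: chart_neq0 (const_xj_neq0 C xj) (rf_den_homog r) (rf_den_nz r).
have [p pP] := choice lift.
have [m pm] := noethA p.
have [v [Ov nMv] ev] := pP m; have [_ bm0 _] := bbad m.
have [O1 OB OM] := regular_subring C x.
have [c Oc ec] : exists2 c, O c & e (p m) = c * (b m * t).
  apply: (in_span_sub (Q := fun z => exists2 c, O c & e z = c * (b m * t))) pm.
  - by exists 0; [exact/vanishes_regular/vanishes0|rewrite mul0r rmorph0].
  - move=> z z' [d Od zd] [d' Od' zd']; exists (d - d'); first exact: OB.
    by rewrite rmorphB zd zd' mulrBl.
  - move=> a _ _ /mapP[i + ->]; rewrite mem_iota add0n => /andP[_ im].
    have [w [Ow _] ew] := pP i.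
    exists (e a * w * t ^+ (m - i).-1).
      apply: (OM); first exact: OM.
      elim: (m - i).-1 => [|s IH]; first exact: O1.
      by rewrite exprS; apply: (OM) => //; apply: vanishes_regular.
    rewrite rmorphM ew (bt i (m - i)%N) subnKC; last exact: ltnW.
    have {1}-> : (m - i = (m - i).-1.+1)%N by rewrite prednK // subn_gt0.
    by rewrite exprS; ring.
apply: nMv; have -> : v = c * t.
  by apply: (mulfI bm0); rewrite -ev ec; ring.
exact: vanishesM.
Qed.

Lemma order_exists f : f != 0 -> exists u (m : int), [/\ O u, ~ M u & f = u * t ^ m].
Proof.
move=> f0; have [t0 Mt tgen] := tP.
have [j xj] := hcoord_neq0 x; pose nzj := nonzero_on_var Cx xj.
have [r fr] : exists r, f = \pi_K r by exists (repr f); rewrite reprK.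
pose num := local_chart Cx xj (rf_num r); pose den := local_chart Cx xj (rf_den r).
have fE : f = num / den by rewrite fr (chart_frac nzj r (const_xj_neq0 C xj)).
have num0 : num != 0 by apply: contraNneq f0 => num0; rewrite fE num0 mul0r.
have den0 : den != 0 by apply: contraNneq f0 => den0; rewrite fE den0 invr0 mulr0.
have [u [a [Ou Mu numE]]] := regular_order (regular_local_chart Cx xj _) num0.
have [v [b [Ov Mv denE]]] := regular_order (regular_local_chart Cx xj _) den0.
have [Ov' Mv'] := regularV Cx Ov Mv.
exists (u / v), (a%:Z - b%:Z); split; first exact: regularM.
  exact: not_vanishesM.
rewrite fE [num]numE [den]denE invfM mulrACA expfzDr // -invr_expz.
by rewrite -!exprnP.
Qed.

End Uniformizer.

(** * Valuations *)

Section Orders.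

Variables (k : closedFieldType) (n : nat) (C : smooth_projective_curve k n).
Variables (x : pspace k n) (Cx : on_curve C x).
Local Notation K := (function_field C).
Local Notation O := (@regular_at k n C x).
Local Notation M := (@vanishes_at k n C x).
Implicit Types (f g t u : K).

Lemma regular_unit_expz t u (m : int) : uniformizer_at x t -> O u -> ~ M u ->
  O (u * t ^ m) <-> (0 <= m)%R.
Proof.
move=> [t0 Mt _] Ou nMu; have [O1 _ OM] := regular_subring C x.
have OX (l : nat) : O (t ^+ l).
  elim: l => [|l IH]; first exact: O1.
  by rewrite exprS; apply: (OM) => //; apply: vanishes_regular.
case: m => l; first by split=> // _; apply: OM => //; apply: OX.
split=> // Otl; exfalso; apply: nMu.
(* [Negz l] is -(l + 1), so one factor [t] beyond [t ^+ l] is left over and makes [u] vanish. *)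
have -> : u = u * t ^ Negz l * t ^+ l * t.
  by rewrite -mulrA -exprSr NegzE -invr_expz -exprnP mulfVK // expf_neq0.
by apply: vanishesM => //; apply: OM => //; apply: OX.
Qed.

Lemma ord_atP f : f != 0 -> exists2 m, ord_at x f = Some m & is_order_at x f m.
Proof.
move=> f0; rewrite /ord_at (negPf f0); exists (xget 0 (is_order_at x f)) => //.
apply: xgetPex; have [t tP] := uniformizer_exists Cx.
by have [u [m [Ou Mu fE]]] := order_exists Cx tP f0; exists m, t, u.
Qed.

Lemma order_ge0_regular f : order_ge0 (ord_at x f) <-> O f.
Proof.
have [->|f0] := eqVneq f 0.
  by rewrite /ord_at eqxx; split=> // _; apply/vanishes_regular/vanishes0.
have [m -> [t [u [tP Ou nMu ->]]]] := ord_atP f0.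
by rewrite (regular_unit_expz m tP Ou nMu).
Qed.

Lemma order_lt0_regular f : order_lt0 (ord_at x f) <-> ~ O f.
Proof.
rewrite -order_ge0_regular; case: (ord_at x f) => [m|] /=; last by split.
by rewrite ltNge; split=> /negP.
Qed.

(** A single uniformizer serves all functions here, whereas [ord_at] may choose one for each
    function. The value at 0 is arbitrary. *)
Lemma valuation_exists : exists v : K -> int,
  [/\ forall f, f != 0 -> O f <-> (0 <= v f)%R,
      forall f, f != 0 -> M f <-> (0 < v f)%R,
      forall f g, f != 0 -> g != 0 -> v (f * g) = v f + v g
    & forall f g, f != 0 -> g != 0 -> f + g != 0 ->
        (v f <= v (f + g))%R \/ (v g <= v (f + g))%R].
Proof.
have [t tP] := uniformizer_exists Cx; have [t0 Mt tgen] := tP.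
have ex f : exists m : int, f != 0 -> exists u, [/\ O u, ~ M u & f = u * t ^ m].
  have [->|f0] := eqVneq f 0; first by exists 0.
  by have [u [m ufm]] := order_exists Cx tP f0; exists m => _; exists u.
have [v vP] := choice ex; exists v.
(* This characterization of [v] reduces its properties to closure properties of the local ring. *)
have geP f m : f != 0 -> O (f * t ^ (- m)) <-> (m <= v f)%R.
  move=> f0; have [u [Ou nMu {1}->]] := vP f f0.
  by rewrite -mulrA -expfzDr // (regular_unit_expz _ tP Ou nMu) subr_ge0.
have OvP f : f != 0 -> O f <-> (0 <= v f)%R.
  by move=> f0; rewrite -geP // oppr0 expr0z mulr1.
split=> //.
- move=> f f0; rewrite gtz0_ge1 -geP //; split=> [/tgen[g Og ->]|Oft].
    by rewrite -invr_expz expr1z mulfK.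
  have -> : f = f * t ^ (- 1%:Z) * t by rewrite -invr_expz expr1z divfK.
  exact: vanishesM.
- move=> f g f0 g0; have fg0 : f * g != 0 by rewrite mulf_neq0.
  have [u [Ou1 Mu fE]] := vP f f0; have [w [Ow Mw gE]] := vP g g0.
  have fgE : f * g = u * w * t ^ (v f + v g).
    by rewrite {1}fE {1}gE expfzDr //; ring.
  have Ouw : O (u * w) by apply: regularM.
  have nMuw : ~ M (u * w) by apply: not_vanishesM.
  have le m : (m <= v (f * g))%R <-> (m <= v f + v g)%R.
    rewrite -geP // fgE -mulrA -expfzDr // (regular_unit_expz _ tP Ouw nMuw).
    by rewrite subr_ge0.
  by apply: le_anti; rewrite (le _).1 //= (le _).2.
- move=> f g f0 g0 fg0; have [_ OB _] := regular_subring C x.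
  have O0 : O 0 by apply/vanishes_regular/vanishes0.
  have OD a b : O a -> O b -> O (a + b).
    by move=> Oa Ob; rewrite -[b]opprK -[- b]sub0r; apply: (OB) => //; apply: OB.
  have [fg|/ltW gf] := leP (v f) (v g); [left|right]; apply/geP => //.
    by rewrite mulrDl; apply: OD; apply/geP.
  by rewrite mulrDl; apply: OD; apply/geP.
Qed.

End Orders.

Lemma SL2_not_finitely_generated_valuation (R : comNzRingType) (K : fieldType)
    (iota : {rmorphism R -> K}) (v : K -> int) (f0 : R) : injective iota ->
  (forall f g, f != 0 -> g != 0 -> v (f * g) = v f + v g) ->
  (forall f g, f != 0 -> g != 0 -> f + g != 0 ->
    (v f <= v (f + g))%R \/ (v g <= v (f + g))%R) ->
  (forall f, iota f != 0 -> (v (iota f) <= 0)%R) ->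
  iota f0 != 0 -> (v (iota f0) < 0)%R -> ~ finitely_generated (SL 2 R).
Proof.
move=> inj vMul vD v_le0 f0_neq0 v_lt0.
have iota_eq0 f : (iota f == 0) = (f == 0) by rewrite -(rmorph0 iota) (inj_eq inj).
(* Since [v] is nonpositive on the nonzero elements of the ring, the absolute value is its negative
   and remains additive. *)
pose nu f := if f == 0 then 0%N else (2 ^ `|v (iota f)|)%N.
have nuE f : iota f != 0 -> nu f = (2 ^ `|v (iota f)|)%N.
  by rewrite iota_eq0 /nu => /negPf->.
have nu0 f : iota f = 0 -> nu f = 0%N by move/eqP; rewrite iota_eq0 /nu => ->.
apply: (@SL2_not_finitely_generated R nu _ _ _ f0).
- move=> f g; have iM : iota (f * g) = iota f * iota g := rmorphM iota f g.
  have [f_eq0|f_neq0] := eqVneq (iota f) 0.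
    by rewrite (nu0 f) // nu0 // iM f_eq0 mul0r.
  have [g_eq0|g_neq0] := eqVneq (iota g) 0.
    by rewrite (nu0 g) // nu0 ?muln0 // iM g_eq0 mulr0.
  have fg_neq0 : iota (f * g) != 0 by rewrite iM mulf_neq0.
  rewrite !nuE // -expnD iM vMul //; congr (2 ^ _)%N.
  have := v_le0 f f_neq0; have := v_le0 g g_neq0.
  by move: (v (iota f)) (v (iota g)) => *; lia.
- move=> f g; have iD : iota (f + g) = iota f + iota g := rmorphD iota f g.
  have [f_eq0|f_neq0] := eqVneq (iota f) 0.
    have -> : f = 0 by apply/eqP; rewrite -iota_eq0 f_eq0.
    by rewrite add0r leq_maxr.
  have [g_eq0|g_neq0] := eqVneq (iota g) 0.
    have -> : g = 0 by apply/eqP; rewrite -iota_eq0 g_eq0.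
    by rewrite addr0 leq_maxl.
  have [fg_eq0|fg_neq0] := eqVneq (iota (f + g)) 0; first by rewrite nu0.
  rewrite !nuE // leq_max !leq_exp2l //.
  have := v_le0 (f + g) fg_neq0.
  have := v_le0 f f_neq0; have := v_le0 g g_neq0.
  rewrite iD in fg_neq0 *; have := vD _ _ f_neq0 g_neq0 fg_neq0.
  by move: (v _) (v _) (v _) => *; lia.
- move=> f; rewrite /nu; case: (boolP (f == 0)) => // _.
  by rewrite expn_eq0.
rewrite nuE // -[1%N]/(2 ^ 0)%N ltn_exp2l //.
by move: (v (iota f0)) v_lt0 => *; lia.
Qed.

Theorem proposition4p1 (R : comNzRingType) (hR : one_place_ring R) :
  ~ finitely_generated (SL 2 R).
Proof.
have [k [n [C [S1 [iota [inj [S1_neq0 S1C] [f0 f0nc] reg pole]]]]]] := hR.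
have [x xS] : exists x, x \in S1.
  by case: S1 S1_neq0 {S1C reg pole} => // x s _; exists x; apply: mem_head.
have Cx := S1C x xS.
(* A pole at any other point of [S1] would force one at [x], and there are none outside [S1]. *)
have regular f : regular_at x (iota f) -> exists c, iota f = ff_const C c.
  move=> Of; apply: regular_everywhere_const => y Cy.
  have [yS|yS] := boolP (y \in S1); last by apply/(order_ge0_regular Cy)/reg.
  apply: contrapT => /(order_lt0_regular Cy) lt0.
  by have /(order_lt0_regular Cx) := pole f (ex_intro2 _ _ y yS lt0) x xS.
have [v [vO vM vMul vD]] := valuation_exists Cx.
have v_le0 f : iota f != 0 -> (v (iota f) <= 0)%R.
  move=> f_neq0; rewrite leNgt; apply/negP => /(vM _ f_neq0) Mf.
  have [c fc] := regular f (vanishes_regular Mf).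
  have c0 : 0 = c.
    apply: (is_val_uniq Cx (f := iota f)); first exact/vanishes_atP.
    by rewrite fc; apply: is_val_const.
  by rewrite fc -c0 rmorph0 eqxx in f_neq0.
have f_neq0 : iota f0 != 0.
  by apply/eqP => f00; apply: (f0nc 0); rewrite f00 rmorph0.
apply: (SL2_not_finitely_generated_valuation inj vMul vD v_le0 f_neq0).
by rewrite ltNge; apply/negP => /(vO _ f_neq0)/regular[c /f0nc].
Qed.
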